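(* Let $n\ge2$. For each $\lambda\in\mathbb{C}\smallsetminus\{0\}$, the set $\mathrm{Per}_1(\lambda)\subset\mathcal{M}\cong\mathbb{C}^2$ can be described as a smooth curve of the form $$Y=-2X^n+\big(n(\lambda+\lambda^{-1}+1)-1\big)X^{n-1}+\cdots+\lambda(n-\lambda)^{n-1}/n^n,$$ that is, as the graph of a polynomial function of $X$ of degree $n$ whose coefficients of $X^n$, $X^{n-1}$ and $X^0$ are as displayed. If $\lambda\ne\lambda'$ with $\lambda\lambda'\neq0$ and $\lambda\lambda'\ne1$, then the two curves $\mathrm{Per}_1(\lambda)$ and $\mathrm{Per}_1(\lambda')$ have exactly $n-1$ points of intersection in $\mathcal{M}$, counted with multiplicity.
   Context: A rational map $f:\widehat{\mathbb{C}}\to\widehat{\mathbb{C}}$ of degree $n\ge2$ is bicritical if it has exactly two critical points. $\mathcal{M}$ denotes the set of conjugacy classes $(f)$ of degree $n$ bicritical maps under Möbius conjugation. Every bicritical map is conjugate to one of the form $f(z)=(az^n+b)/(cz^n+d)$ with $ad-bc\ne0$; the quantities $X=bc/(ad-bc)$ and $Y=\big(a^{n+1}b^{n-1}+c^{n-1}d^{n+1}\big)/(ad-bc)^n$ depend only on $(f)$, and $(X,Y)$ identifies $\mathcal{M}$ with $\mathbb{C}^2$. $\mathrm{Per}_1(\lambda)\subset\mathcal{M}$ is the set of all $(f)$ such that $f$ has a fixed point of multiplier $\lambda$. *)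

(* Defs.v *)
From HB Require Import structures.
From mathcomp Require Import all_boot all_order all_algebra.
From mathcomp Require Import complex.
From mathcomp Require Import boolp classical_sets reals.

Set Implicit Arguments.
Unset Strict Implicit.
Unset Printing Implicit Defensive.

Import GRing.Theory Num.Theory.
Local Open Scope classical_set_scope.
Local Open Scope ring_scope.

(** * Rational maps of the Riemann sphere *)

(* K together with the point at infinity [None]. *)
Definition sphere (K : Type) : Type := option K.

(* A rational map is presented by a fraction in lowest terms; the fraction is
   determined by the map only up to a common scalar, which none of the notions
   below sees (in particular [conj_class f] contains every presentation
   of the map f). *)
Record ratmap (K : fieldType) : Type := RatMap {
  rnum : {poly K};
  rden : {poly K};
  ratmap_coprime : coprimep rnum rden }.

Section RationalMaps.
Variable K : fieldType.
Implicit Types (p q : {poly K}) (f g mu : ratmap K) (a b c d x : K).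

Definition rdegree f : nat := (maxn (size (rnum f)) (size (rden f))).-1.

(* w ^ d * p (1 / w), when p has degree at most d. *)
Definition recip (d : nat) p : {poly K} := \poly_(i < d.+1) p`_(d - i).

(* The numerator and denominator of w |-> f (1 / w): f near infinity. *)
Definition rnum_inf f : {poly K} := recip (rdegree f) (rnum f).
Definition rden_inf f : {poly K} := recip (rdegree f) (rden f).

Definition frac_eval p q x : sphere K :=
  if q.[x] == 0 then None else Some (p.[x] / q.[x]).

Definition reval f (z : sphere K) : sphere K :=
  match z with
  | Some x => frac_eval (rnum f) (rden f) x
  | None => frac_eval (rnum_inf f) (rden_inf f) 0
  end.

(* The derivative of p / q at x, by the quotient rule. *)
Definition quot_deriv p q x : K :=
  (p^`() * q - p * q^`()).[x] / q.[x] ^+ 2.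

(* The derivative of p / q at x or, if x is a pole, that of q / p. *)
Definition frac_deriv p q x : K :=
  if q.[x] == 0 then quot_deriv q p x else quot_deriv p q x.

(* The derivative of f at z, read in the coordinate z at finite points and in
   the coordinate 1 / z at infinity, both in the source and in the target. *)
Definition chart_deriv f (z : sphere K) : K :=
  match z with
  | Some x => frac_deriv (rnum f) (rden f) x
  | None => frac_deriv (rnum_inf f) (rden_inf f) 0
  end.

Definition critical_points f : set (sphere K) :=
  [set z | chart_deriv f z = 0].

Definition bicritical f : Prop :=
  exists z1 z2, z1 <> z2 /\ critical_points f = [set z1; z2].

(* At a fixed point source and target carry the same coordinate, so that
   [chart_deriv] is the multiplier. *)
Definition has_fixed_point_of_multiplier f (lam : K) : Prop :=
  exists z, reval f z = z /\ chart_deriv f z = lam.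

(* Moebius conjugacy: Moebius maps are the rational maps of degree 1. *)
Definition conjugate f g : Prop :=
  exists mu, rdegree mu = 1%N /\
    forall z, reval mu (reval f z) = reval g (reval mu z).

(** * Moduli space of bicritical maps *)

Definition conj_class f : set (ratmap K) := [set g | conjugate f g].

Definition moduli (n : nat) : set (set (ratmap K)) :=
  [set conj_class f | f in [set f | rdegree f = n /\ bicritical f]].

Definition Per1 (n : nat) (lam : K) : set (set (ratmap K)) :=
  [set conj_class f | f in [set f | [/\ rdegree f = n, bicritical f
                                     & has_fixed_point_of_multiplier f lam]]].

Definition is_normal_form (n : nat) f a b c d : Prop :=
  [/\ a * d - b * c != 0,
      rnum f = a *: 'X^n + b%:P & rden f = c *: 'X^n + d%:P].

Definition invX a b c d : K := b * c / (a * d - b * c).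

Definition invY (n : nat) a b c d : K :=
  (a ^+ n.+1 * b ^+ n.-1 + c ^+ n.-1 * d ^+ n.+1) / (a * d - b * c) ^+ n.

(* The coordinates (X, Y) of a conjugacy class, computed from any normal form
   in it; over the complex numbers every class in [moduli n] with 2 <= n
   contains a normal form and (X, Y) does not depend on its choice, so that the
   default value (0, 0) is only used outside [moduli n]. *)
Definition coordXY (n : nat) (m : set (ratmap K)) : K * K :=
  xget (0, 0)
    [set xy | exists f a b c d, [/\ m f, is_normal_form n f a b c d
                                  & xy = (invX a b c d, invY n a b c d)]].

End RationalMaps.

(** * Intersection multiplicity of plane curves *)

Section IntersectionMultiplicity.
Variable K : fieldType.
Implicit Types (F G : {poly {poly K}}) (A B : set (K * K)) (p : K * K).

(* In {poly {poly K}} the inner variable is X and the outer one is Y. *)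
Definition eval2 F p : K := F.[(p.2)%:P].[p.1].

Definition vanishing_ideal A : set {poly {poly K}} :=
  [set F | forall p, A p -> eval2 F p = 0].

Definition local_ring p : set {fraction {poly {poly K}}} :=
  [set r | exists F G, eval2 G p != 0 /\ r = tofrac F / tofrac G].

(* The ideal I(A) O_p + I(B) O_p of the local ring O_p. *)
Definition local_ideal A B p : set {fraction {poly {poly K}}} :=
  [set r | exists s t F G,
     [/\ local_ring p s, local_ring p t, vanishing_ideal A F,
         vanishing_ideal B G & r = s * tofrac F + t * tofrac G]].

(* The intersection multiplicity at p of the (reduced) curves A and B is d:
   O_p / (I(A) + I(B)) O_p has a K-basis of d elements. *)
Definition intersection_multiplicity A B p (d : nat) : Prop :=
  exists e : 'I_d -> {fraction {poly {poly K}}},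
    (forall i, local_ring p (e i)) /\
    forall r, local_ring p r ->
      exists! c : 'rV[K]_d,
        local_ideal A B p (r - \sum_(i < d) tofrac ((c 0 i)%:P%:P) * e i).

End IntersectionMultiplicity.

(* Main.v *)
Require Import Defs.
From HB Require Import structures.
From mathcomp Require Import all_boot all_order all_algebra.
From mathcomp Require Import complex.
From mathcomp Require Import boolp classical_sets reals.
From mathcomp Require Import ring.

(* A map of degree [n] lifts to a homogeneous map [F] of the plane, and a Moebius
   conjugacy to a linear conjugacy of the lifts up to a constant.  Critical
   points are the zeros of the Jacobian [J] of [F], and [f] has a fixed point of
   multiplier [lam] iff [F v = e v] and [J v = n e^2 lam] for some [v, e <> 0], so
   both notions are invariant under conjugacy.  Moving the two critical points of
   a bicritical map to 0 and infinity makes its Wronskian a monomial, which forces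
   the normal form [(a z^n + b) / (c z^n + d)]; a conjugacy of normal forms is
   diagonal or antidiagonal, which shows that [(X, Y)] is well defined and
   injective.

   At a fixed point [(u, v)] of a normal form put [p = a u^n / (e u)],
   [q = d v^n / (e v)] and [l = lam / n].  Then [p + q = 1 + l],
   [p q = l (X + 1)], and [l^n Y] is the power sum
   [p^2 (p (1 - p))^(n-1) + q^2 (q (1 - q))^(n-1)], which satisfies a linear
   recursion with coefficients in [X].  Two of the resulting graphs [Y = P(X)] and
   [Y = P'(X)] meet above the roots of [P - P'], with the multiplicities of these
   roots, and [P - P'] has degree [n - 1]. *)

Set Implicit Arguments.
Unset Strict Implicit.
Unset Printing Implicit Defensive.

Import GRing.Theory Num.Theory.
Local Open Scope classical_set_scope.
Local Open Scope ring_scope.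

(** * Homogeneous forms in two variables *)

Section HomogeneousForms.
Variable K : numClosedFieldType.
Implicit Types (p q A B : {poly K}) (u v a b c x : K) (d i : nat).

(** In characteristic 0 the integers below [size p] are distinct, while a nonzero [p] has fewer
    roots than its size. *)
Lemma poly_zero_fun p : (forall x, p.[x] = 0) -> p = 0.
Proof.
move=> p0; apply/eqP; apply/negP => /negP pn0.
have := @max_poly_roots _ p [seq i%:R | i <- iota 0 (size p)] pn0.
rewrite size_map size_iota ltnn => H; suff: false by [].
apply: H; first by apply/allP => x _; rewrite /root p0.
by rewrite map_inj_uniq ?iota_uniq // => i j /eqP; rewrite eqr_nat => /eqP.
Qed.

Lemma poly_eq_fun p q : (forall x, p.[x] = q.[x]) -> p = q.
Proof.
move=> pq; apply/eqP; rewrite -subr_eq0; apply/eqP; apply: poly_zero_fun => x.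
by rewrite hornerD hornerN pq subrr.
Qed.

Lemma poly_eq_off0 p q : (forall x, x != 0 -> p.[x] = q.[x]) -> p = q.
Proof.
move=> pq; apply: (@mulfI _ 'X); first by rewrite polyX_eq0.
apply: poly_eq_fun => x; rewrite !hornerM hornerX.
by have [->|/pq->//] := eqVneq x 0; rewrite !mul0r.
Qed.

(* [v ^ d * p (u / v)], for [p] of degree at most [d]. *)
Definition homog d p u v : K := \sum_(i < d.+1) p`_i * (u ^+ i * v ^+ (d - i)).
(** The formal partial derivatives of [homog]; wherever the predecessor of an exponent is truncated,
    the factor in front is 0. *)
Definition hom_du d p u v : K :=
  \sum_(i < d.+1) p`_i * ((i%:R * u ^+ i.-1) * v ^+ (d - i)).
Definition hom_dv d p u v : K :=
  \sum_(i < d.+1) p`_i * (u ^+ i * ((d - i)%:R * v ^+ (d - i).-1)).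

Definition jac d p q u v : K :=
  hom_du d p u v * hom_dv d q u v - hom_dv d p u v * hom_du d q u v.

(** The form along the polynomial curve [(A, B)]: as polynomials in one variable, identities between
    forms can be differentiated and extended by continuity. *)
Definition hom_subst d p A B : {poly K} :=
  \sum_(i < d.+1) p`_i *: (A ^+ i * B ^+ (d - i)).

Lemma horner_hom_subst d p A B x :
  (hom_subst d p A B).[x] = homog d p A.[x] B.[x].
Proof.
rewrite /hom_subst /homog horner_sum; apply: eq_bigr => i _.
by rewrite hornerZ hornerM !horner_exp.
Qed.

Lemma deriv_hom_subst d p A B x :
  (hom_subst d p A B)^`().[x] =
  hom_du d p A.[x] B.[x] * A^`().[x] + hom_dv d p A.[x] B.[x] * B^`().[x].
Proof.
rewrite /hom_subst /hom_du /hom_dv raddf_sum horner_sum !mulr_suml -big_split.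
apply: eq_bigr => i _ /=.
rewrite derivZ derivM !deriv_exp -mulr_natl -[_ *+ (d - i)]mulr_natl.
rewrite !(hornerZ, hornerD, hornerM, horner_exp, hornerMn, hornerC).
by ring.
Qed.

Lemma homD d p q u v : homog d (p + q) u v = homog d p u v + homog d q u v.
Proof.
rewrite /homog -big_split; apply: eq_bigr => i _; rewrite coefD /=. by rewrite mulrDl.
Qed.

Lemma homZ d c p u v : homog d (c *: p) u v = c * homog d p u v.
Proof. by rewrite /homog mulr_sumr; apply: eq_bigr => i _; rewrite coefZ -mulrA. Qed.

Lemma hom_scale d p c u v : homog d p (c * u) (c * v) = c ^+ d * homog d p u v.
Proof.
rewrite /homog mulr_sumr; apply: eq_bigr => -[i /= lti] _; rewrite !exprMn.
have -> : c ^+ d = c ^+ i * c ^+ (d - i) by rewrite -exprD subnKC.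
by ring.
Qed.

Lemma hom_du_scale d p c u v :
  hom_du d p (c * u) (c * v) = c ^+ d.-1 * hom_du d p u v.
Proof.
rewrite /hom_du mulr_sumr; apply: eq_bigr => -[[|i] lti] _ /=; first by ring.
rewrite !exprMn.
have -> : d.-1 = (i + (d - i.+1))%N by case: d lti => // d; rewrite !ltnS => /subnKC.
by rewrite exprD; ring.
Qed.

Lemma hom_dv_scale d p c u v :
  hom_dv d p (c * u) (c * v) = c ^+ d.-1 * hom_dv d p u v.
Proof.
rewrite /hom_dv mulr_sumr; apply: eq_bigr => -[i /= lti] _.
case E: (d - i)%N => [|k] /=; first by ring.
rewrite !exprMn; have -> : d.-1 = (i + k)%N.
  by rewrite ltnS in lti; rewrite -(subnKC lti) E addnS.
by rewrite exprD; ring.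
Qed.

Lemma jac_scale d p q c u v :
  jac d p q (c * u) (c * v) = (c ^+ d.-1) ^+ 2 * jac d p q u v.
Proof. by rewrite /jac !hom_du_scale !hom_dv_scale; ring. Qed.

(** Euler's relation, checked on each monomial through [i + (d - i) = d]. *)
Lemma hom_euler d p u v :
  u * hom_du d p u v + v * hom_dv d p u v = d%:R * homog d p u v.
Proof.
rewrite /hom_du /hom_dv /homog !mulr_sumr -big_split; apply: eq_bigr => -[i /= lti] _.
have -> : d%:R = i%:R + (d - i)%:R :> K by rewrite -natrD subnKC.
have E k (w : K) : w * (k%:R * w ^+ k.-1) = k%:R * w ^+ k.
  by case: k => [|k] /=; rewrite ?mul0r ?mulr0 // exprS; ring.
transitivity (p`_i * ((u * (i%:R * u ^+ i.-1)) * v ^+ (d - i)) +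
   p`_i * (u ^+ i * (v * ((d - i)%:R * v ^+ (d - i).-1)))); first by ring.
by rewrite !E; ring.
Qed.

Lemma hom_x1 d p x : (size p <= d.+1)%N -> homog d p x 1 = p.[x].
Proof.
move=> szp; rewrite (horner_coef_wide _ szp); apply: eq_bigr => i _.
by rewrite expr1n mulr1.
Qed.

Lemma hom_10 d p : homog d p 1 0 = p`_d.
Proof.
rewrite /homog big_ord_recr /= subnn expr0 expr1n !mulr1 big1 ?add0r // => i _.
by rewrite expr0n subn_eq0 leqNgt ltn_ord /= !mulr0.
Qed.

Lemma hom_du_x1 d p x : (size p <= d.+1)%N -> hom_du d p x 1 = p^`().[x].
Proof.
move=> szp.
have -> : p = hom_subst d p 'X 1.
  by apply: poly_eq_fun => y; rewrite horner_hom_subst hornerX hornerC hom_x1.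
rewrite deriv_hom_subst hornerX hornerC derivX derivC !hornerC mulr1 mulr0 addr0.
congr hom_du; apply: poly_eq_fun => y.
by rewrite horner_hom_subst hornerX hornerC hom_x1.
Qed.

Lemma hom_du_10 d p : hom_du d p 1 0 = d%:R * p`_d.
Proof. by rewrite -hom_10 -hom_euler mul0r addr0 mul1r. Qed.

Lemma hom_dv_10 d p : (0 < d)%N -> hom_dv d p 1 0 = p`_d.-1.
Proof.
case: d => // d _; rewrite /hom_dv !big_ord_recr /= subnn !mul0r !mulr0 addr0.
rewrite subSn // subnn !expr1n !mul1r !mulr1 big1 ?add0r // => i _.
rewrite subSn ?(ltnW (ltn_ord i)) //= expr0n subn_eq0 leqNgt ltn_ord /=.
by rewrite !mulr0.
Qed.

(** Euler's relation eliminates [hom_dv]; the two terms carrying the factor [x] cancel and the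
    Wronskian remains. *)
Lemma jac_x1 d p q x : (size p <= d.+1)%N -> (size q <= d.+1)%N ->
  jac d p q x 1 = d%:R * (p^`() * q - p * q^`()).[x].
Proof.
move=> szp szq; have := hom_euler d p x 1; have := hom_euler d q x 1.
rewrite /jac !hom_x1 // !hom_du_x1 // !mul1r => Eq Ep.
rewrite !(hornerD, hornerN, hornerM).
have -> : hom_dv d p x 1 = d%:R * p.[x] - x * p^`().[x] by rewrite -Ep; ring.
have -> : hom_dv d q x 1 = d%:R * q.[x] - x * q^`().[x] by rewrite -Eq; ring.
by ring.
Qed.

Lemma jac_10 d p q : (0 < d)%N ->
  jac d p q 1 0 = d%:R * (p`_d * q`_d.-1 - p`_d.-1 * q`_d).
Proof. by move=> d0; rewrite /jac !hom_du_10 !hom_dv_10 //; ring. Qed.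

Lemma size_hom_subst_lin d p a b c e :
  (size (hom_subst d p (a *: 'X + b%:P) (c *: 'X + e%:P)) <= d.+1)%N.
Proof.
have szl (s t : K) : (size (s *: 'X + t%:P)%R <= 2)%N.
  rewrite (leq_trans (size_polyD _ _)) // geq_max (leq_trans (size_scale_leq _ _)) ?size_polyX //.
  by rewrite (leq_trans (size_polyC_leq1 _)).
have szX (A : {poly K}) k : (size A <= 2)%N -> (size (A ^+ k)%R <= k.+1)%N.
  move=> sA; rewrite (leq_trans (size_poly_exp_leq _ _)) // ltnS.
  by rewrite -{2}(mul1n k) leq_mul2r; case: (size A) sA => [|[|[|]]]; rewrite ?orbT.
apply: (leq_trans (size_sum _ _ _)); apply/bigmax_leqP => i _.
rewrite (leq_trans (size_scale_leq _ _)) // (leq_trans (size_polyMleq _ _)) //.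
have := szX _ i (szl a b); have := szX _ (d - i)%N (szl c e) => h2 h1.
have := leq_add h1 h2; rewrite addSn addnS subnKC; last by rewrite -ltnS.
by case: (_ + _)%N => // k; rewrite ltnS.
Qed.

(* Homogeneous forms are determined by their values on the line [v = 1]; the
   point at infinity is reached by polynomial continuity in [v]. *)
Lemma hom_hom_subst d p a b c e u v : (size p <= d.+1)%N ->
  homog d (hom_subst d p (a *: 'X + b%:P) (c *: 'X + e%:P)) u v =
  homog d p (a * u + b * v) (c * u + e * v).
Proof.
move=> szp; set g := hom_subst _ _ _ _.
have szg : (size g <= d.+1)%N by exact: size_hom_subst_lin.
suff -> : homog d g u v = (hom_subst d g u%:P 'X).[v].
  have -> : homog d p (a * u + b * v) (c * u + e * v) =
      (hom_subst d p ((a * u)%:P + b *: 'X) ((c * u)%:P + e *: 'X)).[v].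
    by rewrite horner_hom_subst !hornerE.
  congr (_.[v]); apply: poly_eq_off0 => w w0.
  rewrite !horner_hom_subst !hornerE.
  have -> : homog d g u w = w ^+ d * homog d g (u / w) 1.
    by rewrite -hom_scale mulrC divfK // mulr1.
  rewrite hom_x1 // /g horner_hom_subst -hom_scale !(hornerD, hornerZ, hornerX, hornerC).
  by congr homog; field.
by rewrite horner_hom_subst !hornerE.
Qed.

End HomogeneousForms.

(** * Homogeneous lifts of rational maps *)

Section HomogeneousCoordinates.
Variable K : numClosedFieldType.
Implicit Types (f g mu : ratmap K) (u v a b c d e x lam : K) (z : sphere K).

Definition proj_pt u v : sphere K := if v == 0 then None else Some (u / v).

Definition nonzero u v : bool := (u != 0) || (v != 0).

Definition fnum f u v : K := homog (rdegree f) (rnum f) u v.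
Definition fden f u v : K := homog (rdegree f) (rden f) u v.
Definition fjac f u v : K := jac (rdegree f) (rnum f) (rden f) u v.

(** The denominator of the chart around [z] is normalised to 1, so that eigenvalues of the lift can
    be read off a coordinate. *)
Definition rep z : K * K := if z is Some x then (x, 1) else (1, 0).

Lemma nonzero_rep z : nonzero (rep z).1 (rep z).2.
Proof. by case: z => [x|]; rewrite /nonzero oner_eq0 ?orbT. Qed.

Lemma proj_pt_rep z : proj_pt (rep z).1 (rep z).2 = z.
Proof. by case: z => [x|]; rewrite /proj_pt /= ?eqxx // oner_eq0 divr1. Qed.

Lemma nonzeroP u v : nonzero u v ->
  exists c z, [/\ c != 0, u = c * (rep z).1 & v = c * (rep z).2].
Proof.
rewrite /nonzero; have [->|v0 _] := eqVneq v 0.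
  by rewrite orbF => u0; exists u, None; rewrite mulr1 mulr0.
by exists v, (Some (u / v)); rewrite mulr1 mulrC divfK.
Qed.

Lemma proj_pt_eq u v u' v' : nonzero u v -> nonzero u' v' ->
  (proj_pt u v = proj_pt u' v') <-> u * v' = u' * v.
Proof.
rewrite /nonzero /proj_pt => nz nz'.
case: (eqVneq v 0) nz => [->|v0] nz; case: (eqVneq v' 0) nz' => [->|v'0] nz' //.
- by rewrite !mulr0.
- split=> // /eqP; rewrite mulr0 mulf_eq0 (negbTE v'0) orbF => /eqP u0.
  by rewrite u0 eqxx in nz.
- split=> // /eqP; rewrite mulr0 eq_sym mulf_eq0 (negbTE v0) orbF => /eqP u0.
  by rewrite u0 eqxx in nz'.
- split=> [[/eqP]|E]; first by rewrite eqr_div // => /eqP.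
  by congr Some; apply/eqP; rewrite eqr_div // E.
Qed.

Lemma proj_pt_scale c u v : c != 0 -> proj_pt (c * u) (c * v) = proj_pt u v.
Proof.
move=> c0; rewrite /proj_pt mulf_eq0 (negbTE c0) /=.
by case: eqVneq => // v0; congr Some; rewrite -mulf_div divff // mul1r.
Qed.

Lemma nonzero_scale c u v : c != 0 -> nonzero (c * u) (c * v) = nonzero u v.
Proof. by move=> c0; rewrite /nonzero !mulf_eq0 (negbTE c0). Qed.

Lemma size_rnum f : (size (rnum f) <= (rdegree f).+1)%N.
Proof. by rewrite /rdegree (leq_trans _ (leqSpred _)) // leq_maxl. Qed.

Lemma size_rden f : (size (rden f) <= (rdegree f).+1)%N.
Proof. by rewrite /rdegree (leq_trans _ (leqSpred _)) // leq_maxr. Qed.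

Lemma fnum_x1 f x : fnum f x 1 = (rnum f).[x].
Proof. by rewrite /fnum hom_x1 // size_rnum. Qed.

Lemma fden_x1 f x : fden f x 1 = (rden f).[x].
Proof. by rewrite /fden hom_x1 // size_rden. Qed.

Lemma fnum_10 f : fnum f 1 0 = (rnum f)`_(rdegree f).
Proof. by rewrite /fnum hom_10. Qed.

Lemma fden_10 f : fden f 1 0 = (rden f)`_(rdegree f).
Proof. by rewrite /fden hom_10. Qed.

(** The longer of the two polynomials has its leading coefficient at this index, and the two cannot
    both be 0, being coprime. *)
Lemma nonzero_top f : nonzero (rnum f)`_(rdegree f) (rden f)`_(rdegree f).
Proof.
rewrite /nonzero /rdegree; case: leqP => h.
- have [d0|d0] := eqVneq (rden f) 0; last by rewrite -lead_coefE lead_coef_eq0 d0 orbT.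
  move: h; rewrite d0 size_poly0 leqn0 size_poly_eq0 => /eqP n0.
  by have := ratmap_coprime f; rewrite n0 d0 coprimep0 -size_poly_eq1 size_poly0.
- by rewrite -lead_coefE lead_coef_eq0 -size_poly_gt0 (leq_ltn_trans _ h).
Qed.

Lemma fnum_scale f c u v : fnum f (c * u) (c * v) = c ^+ rdegree f * fnum f u v.
Proof. exact: hom_scale. Qed.

Lemma fden_scale f c u v : fden f (c * u) (c * v) = c ^+ rdegree f * fden f u v.
Proof. exact: hom_scale. Qed.

Lemma fjac_scale f c u v :
  fjac f (c * u) (c * v) = (c ^+ (rdegree f).-1) ^+ 2 * fjac f u v.
Proof. exact: jac_scale. Qed.

Lemma fjac_x1 f x : fjac f x 1 = (rdegree f)%:R *
  ((rnum f)^`() * rden f - rnum f * (rden f)^`()).[x].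
Proof. by rewrite /fjac jac_x1 ?size_rnum ?size_rden. Qed.

(** On the affine line this is coprimality; at infinity it is [nonzero_top]. *)
Lemma nonzero_form f u v : nonzero u v -> nonzero (fnum f u v) (fden f u v).
Proof.
move=> /nonzeroP[c [z [c0 -> ->]]].
rewrite fnum_scale fden_scale nonzero_scale ?expf_neq0 //.
case: z => [x|] /=; last by rewrite fnum_10 fden_10 nonzero_top.
rewrite fnum_x1 fden_x1 /nonzero; have [r0|//] := eqVneq (rnum f).[x] 0.
by apply: (coprimep_root (ratmap_coprime f)); apply/eqP.
Qed.

Lemma coef_recip (d : nat) (p : {poly K}) i :
  (recip d p)`_i = if (i < d.+1)%N then p`_(d - i) else 0.
Proof. by rewrite /recip coef_poly. Qed.

Lemma reval_form f u v : nonzero u v ->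
  reval f (proj_pt u v) = proj_pt (fnum f u v) (fden f u v).
Proof.
move=> /nonzeroP[c [z [c0 -> ->]]].
rewrite fnum_scale fden_scale !proj_pt_scale ?expf_neq0 // proj_pt_rep.
case: z => [x|] /=; first by rewrite fnum_x1 fden_x1.
rewrite fnum_10 fden_10 /frac_eval !horner_coef0 /rnum_inf /rden_inf.
by rewrite !coef_recip !ltn0Sn subn0.
Qed.

Lemma reval_rep f z :
  reval f z = proj_pt (fnum f (rep z).1 (rep z).2) (fden f (rep z).1 (rep z).2).
Proof. by rewrite -reval_form ?nonzero_rep // proj_pt_rep. Qed.

(* The derivative in the charts is, up to the factor [deg f], the Jacobian of
   the homogeneous lift divided by the square of the coordinate that does not
   vanish at the value; the sign records whether the charts at source and target
   agree. *)
Lemma chart_deriv_jac f z : (0 < rdegree f)%N ->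
  let u := (rep z).1 in let v := (rep z).2 in
  (rdegree f)%:R * chart_deriv f z =
    (-1) ^+ ((fden f u v == 0) (+) (v == 0)) * fjac f u v /
      (if fden f u v == 0 then fnum f u v else fden f u v) ^+ 2.
Proof.
move=> d0; case: z => [x|] /=.
  rewrite oner_eq0 addbF fjac_x1 fnum_x1 fden_x1 /frac_deriv /quot_deriv.
  case: eqP => _ /=; rewrite mulrA; congr (_ / _); rewrite !(hornerD, hornerN, hornerM) ?expr1 ?expr0; ring.
rewrite eqxx addbT /fjac jac_10 // fnum_10 fden_10 /= /frac_deriv /quot_deriv.
rewrite !(hornerD, hornerN, hornerM) !horner_coef0 !coef_deriv.
rewrite /rnum_inf /rden_inf !coef_recip !ltnS !leq0n !d0 subn0 subn1 !mulr1n.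
by case: eqP => _ /=; rewrite mulrA; congr (_ / _); rewrite ?expr1 ?expr0; ring.
Qed.

(** In [chart_deriv_jac] the denominator is the square of a nonzero coordinate of the image, and the
    degree is invertible in characteristic 0. *)
Lemma critical_form f u v : (0 < rdegree f)%N -> nonzero u v ->
  critical_points f (proj_pt u v) <-> fjac f u v = 0.
Proof.
move=> d0 /nonzeroP[c [z [c0 -> ->]]]; rewrite proj_pt_scale // proj_pt_rep fjac_scale.
have dn0 : (rdegree f)%:R != 0 :> K by rewrite pnatr_eq0 -lt0n.
have := nonzero_form f (nonzero_rep z); have := chart_deriv_jac z d0.
rewrite /critical_points /= /nonzero; set N := fnum _ _ _; set D := fden _ _ _.
set J := fjac _ _ _; move=> E nz.
have w0 : (if D == 0 then N else D) != 0.
  by case: (eqVneq D 0) nz => [_|//]; rewrite orbF.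
split=> [c1|/eqP].
  move/eqP: E; rewrite c1 mulr0 eq_sym !mulf_eq0 signr_eq0 invr_eq0.
  by rewrite (negbTE (expf_neq0 _ w0)) orbF => /eqP->; rewrite mulr0.
rewrite mulf_eq0 (negbTE (expf_neq0 _ (expf_neq0 _ c0))) /= => /eqP J0.
by apply: (mulfI dn0); rewrite E J0 !(mulr0, mul0r).
Qed.

(* At an eigenvector [F (u, v) = e (u, v)] of the homogeneous lift [F] of [f],
   Euler's relation gives [dF] the eigenvalue [deg f * e] along [(u, v)], and
   the other eigenvalue is [e] times the multiplier. *)
Lemma multiplier_form f lam : (0 < rdegree f)%N ->
  has_fixed_point_of_multiplier f lam <->
  exists u v e, [/\ nonzero u v, e != 0, fnum f u v = e * u, fden f u v = e * v
    & fjac f u v = (rdegree f)%:R * e ^+ 2 * lam].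
Proof.
move=> d0; have dn0 : (rdegree f)%:R != 0 :> K by rewrite pnatr_eq0 -lt0n.
(* At a fixed point the charts at source and target agree, so the sign is 1, and the coordinate of
   the image in the denominator is [e]. *)
have key z e : e != 0 -> fnum f (rep z).1 (rep z).2 = e * (rep z).1 ->
    fden f (rep z).1 (rep z).2 = e * (rep z).2 ->
    (rdegree f)%:R * chart_deriv f z * e ^+ 2 = fjac f (rep z).1 (rep z).2.
  move=> e0 En Ed; rewrite chart_deriv_jac // En Ed mulf_eq0 (negbTE e0) addbb mul1r.
  by case: z {En Ed} => [x|] /=; rewrite ?oner_eq0 ?eqxx mulr1 divfK ?expf_neq0.
split.
- case=> z [fz clam]; pose u := (rep z).1; pose v := (rep z).2.
  have nz := nonzero_rep z; have nzf := nonzero_form f nz.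
  have [e [e0 En Ed]] : exists e, [/\ e != 0, fnum f u v = e * u & fden f u v = e * v].
    move: fz; rewrite -{1 2}(proj_pt_rep z) reval_form // => /(proj_pt_eq nzf nz).
    rewrite -/u -/v => E; move: nzf; rewrite -/u -/v /nonzero => nzf.
    case: (z) @u @v E nzf => [x|] /=.
      rewrite mulr1 => E nzf; exists (fden f x 1); rewrite E mulrC mulr1; split=> //.
      by apply: contraTneq nzf => d1; rewrite E d1 mulr0 eqxx.
    rewrite mulr0 mul1r => /esym E nzf; exists (fnum f 1 0); rewrite E mulr0 mulr1; split=> //.
    by move: nzf; rewrite E eqxx orbF.
  exists u, v, e; split=> //.
  by rewrite -(key _ _ e0 En Ed) clam mulrAC.
- case=> u [v [e [nz e0 En Ed Ej]]]; exists (proj_pt u v); split.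
    by rewrite reval_form // En Ed proj_pt_scale.
  apply: (mulfI dn0); case/nonzeroP: nz En Ed Ej => c [z [c0 -> ->]].
  rewrite proj_pt_scale // proj_pt_rep fnum_scale fden_scale fjac_scale.
  (* Replacing the vector by its representative divides the eigenvalue by [k] and the Jacobian by
     [k ^ 2]. *)
  move=> En Ed Ej; pose k := c ^+ (rdegree f).-1.
  have ck : c ^+ rdegree f = c * k by rewrite -exprS prednK.
  have k0 : k != 0 by rewrite expf_neq0.
  have En' : fnum f (rep z).1 (rep z).2 = e / k * (rep z).1.
    by apply: (mulfI (mulf_neq0 c0 k0)); rewrite -{1}ck En; field.
  have Ed' : fden f (rep z).1 (rep z).2 = e / k * (rep z).2.
    by apply: (mulfI (mulf_neq0 c0 k0)); rewrite -{1}ck Ed; field.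
  have ek0 : e / k != 0 by rewrite mulf_neq0 ?invr_neq0.
  apply: (mulIf (expf_neq0 2 ek0)); rewrite key //.
  apply: (mulfI (expf_neq0 2 k0)); rewrite Ej; field; exact: k0.
Qed.

End HomogeneousCoordinates.

(** * Moebius conjugacy *)

Section MoebiusConjugacy.
Variable K : numClosedFieldType.
Implicit Types (f g mu : ratmap K) (u v a b c d e k x lam : K) (z : sphere K).
Implicit Types (p q : {poly K}) (n : nat).

(** A common root would be a common zero of the forms on the line [v = 1], and a drop of degree a
    common zero at [(1, 0)]. *)
Lemma ratmap_of_forms n p q : (0 < n)%N ->
  (size p <= n.+1)%N -> (size q <= n.+1)%N ->
  (forall u v, nonzero u v -> nonzero (homog n p u v) (homog n q u v)) ->
  exists g, [/\ rnum g = p, rden g = q & rdegree g = n].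
Proof.
move=> n0 szp szq nz.
have cpq : coprimep p q.
  apply/Pdiv.ClosedField.coprimepP => x /eqP px.
  have := nz x 1; rewrite !hom_x1 // /nonzero px oner_eq0 orbT eqxx; exact.
exists (RatMap cpq); split=> //; rewrite /rdegree /=.
have := nz 1 0; rewrite !hom_10 /nonzero oner_eq0 => /(_ isT) top.
suff -> : maxn (size p) (size q) = n.+1 by [].
apply/eqP; rewrite eqn_leq geq_max szp szq /= leq_max.
by case/orP: top => h; apply/orP; [left|right]; apply: contraNT h; rewrite -leqNgt => h; rewrite nth_default.
Qed.

Definition moebius a b c d z : sphere K :=
  proj_pt (a * (rep z).1 + b * (rep z).2) (c * (rep z).1 + d * (rep z).2).

Lemma nonzero_mul a b c d u v : a * d - b * c != 0 -> nonzero u v ->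
  nonzero (a * u + b * v) (c * u + d * v).
Proof.
move=> D; rewrite /nonzero -!negb_and; apply: contra => /andP[/eqP h1 /eqP h2].
rewrite -(mulrI_eq0 u (mulfI D)) -(mulrI_eq0 v (mulfI D)).
have -> : (a * d - b * c) * u = d * (a * u + b * v) - b * (c * u + d * v) by ring.
have -> : (a * d - b * c) * v = a * (c * u + d * v) - c * (a * u + b * v) by ring.
by rewrite h1 h2 !mulr0 subrr eqxx.
Qed.

Lemma moebius_proj a b c d u v : a * d - b * c != 0 -> nonzero u v ->
  moebius a b c d (proj_pt u v) = proj_pt (a * u + b * v) (c * u + d * v).
Proof.
move=> D /nonzeroP[e [z [e0 -> ->]]]; rewrite proj_pt_scale // proj_pt_rep.
by rewrite /moebius -(proj_pt_scale _ _ e0); congr proj_pt; ring.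
Qed.

Lemma moebius_comp a b c d a' b' c' d' z :
  a * d - b * c != 0 -> a' * d' - b' * c' != 0 ->
  moebius a b c d (moebius a' b' c' d' z) =
  moebius (a * a' + b * c') (a * b' + b * d') (c * a' + d * c') (c * b' + d * d') z.
Proof.
move=> D D'; rewrite {2}/moebius moebius_proj ?nonzero_mul ?nonzero_rep //.
by rewrite /moebius; congr proj_pt; ring.
Qed.

Lemma moebius_scalar a z : a != 0 -> moebius a 0 0 a z = z.
Proof.
by move=> a0; rewrite /moebius !mul0r addr0 add0r proj_pt_scale // proj_pt_rep.
Qed.

Lemma moebius_adjK a b c d z : a * d - b * c != 0 ->
  moebius d (- b) (- c) a (moebius a b c d z) = z.
Proof.
move=> D; have D' : d * a - (- b) * (- c) != 0.
  by rewrite mulrNN mulrC.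
rewrite moebius_comp //.
have -> : d * b + - b * d = 0 by ring.
have -> : - c * a + a * c = 0 by ring.
have -> : - c * b + a * d = a * d - b * c by ring.
have -> : d * a + - b * c = a * d - b * c by ring.
exact: moebius_scalar.
Qed.

Lemma homog1 p u v : homog 1 p u v = p`_1 * u + p`_0 * v.
Proof.
by rewrite /homog !big_ord_recl big_ord0 /= !expr0 !expr1 addr0 mulr1 mul1r addrC.
Qed.

Lemma moebius_of_ratmap mu : rdegree mu = 1%N -> exists a b c d,
  a * d - b * c != 0 /\ forall z, reval mu z = moebius a b c d z.
Proof.
move=> mu1; pose a := (rnum mu)`_1; pose b := (rnum mu)`_0.
pose c := (rden mu)`_1; pose d := (rden mu)`_0; exists a, b, c, d.
have N u v : fnum mu u v = a * u + b * v by rewrite /fnum mu1 homog1.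
have D u v : fden mu u v = c * u + d * v by rewrite /fden mu1 homog1.
split; last by move=> z; rewrite reval_rep N D.
(* If the determinant is 0, both forms vanish at [(d, - c)] and at [(b, - a)]. These vectors are
   then 0, so that [(1, 0)] is a common zero as well. *)
apply/eqP=> det0; have nzN u v := @nonzero_form K mu u v.
have /implyP := nzN d (- c); have /implyP := nzN b (- a); have := nzN 1 0.
rewrite /nonzero !N !D oner_eq0 => /(_ isT).
have -> : a * b + b * - a = 0 by ring.
have -> : c * d + d * - c = 0 by ring.
have -> : a * d + b * - c = 0 by rewrite -det0; ring.
have -> : c * b + d * - a = 0 by rewrite -[RHS]oppr0 -det0; ring.
rewrite eqxx !implybF !oppr_eq0 !negb_or !negbK !mulr1 !mulr0 !addr0.
by move=> + /andP[/eqP b0 /eqP a0] /andP[_ /eqP c0]; rewrite a0 c0 eqxx.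
Qed.

Lemma coef_lin a b i :
  (a *: 'X + b%:P)`_i = if i == 0%N then b else if i == 1%N then a else 0.
Proof.
rewrite coefD coefZ coefX coefC; case: i => [|[|i]] /=.
- by rewrite mulr0 add0r.
- by rewrite mulr1 addr0.
by rewrite mulr0 addr0.
Qed.

Lemma size_lin a b : (size (a *: 'X + b%:P)%R <= 2)%N.
Proof.
apply/leq_sizeP => -[|[|i]] // _; by rewrite coef_lin.
Qed.

Lemma ratmap_of_moebius a b c d : a * d - b * c != 0 ->
  exists mu, rdegree mu = 1%N /\ forall z, reval mu z = moebius a b c d z.
Proof.
move=> D.
have [|mu [num den deg]] := ratmap_of_forms (ltn0Sn 0) (size_lin a b) (size_lin c d).
  by move=> u v nz; rewrite !homog1 !coef_lin /= nonzero_mul.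
exists mu; split=> // z.
by rewrite reval_rep /fnum /fden deg num den !homog1 !coef_lin.
Qed.

Lemma conjugateP f g : conjugate f g <-> exists a b c d,
  a * d - b * c != 0 /\
  forall z, moebius a b c d (reval f z) = reval g (moebius a b c d z).
Proof.
split=> [[mu [/moebius_of_ratmap[a [b [c [d [D E]]]]] h]]|[a [b [c [d [D h]]]]]].
  by exists a, b, c, d; split=> // z; rewrite -!E.
have [mu [mu1 E]] := ratmap_of_moebius D.
by exists mu; split=> // z; rewrite !E.
Qed.

Lemma conjugate_refl f : conjugate f f.
Proof.
apply/conjugateP; exists 1, 0, 0, 1; split=> [|z].
  by rewrite mulr1 mulr0 subr0 oner_eq0.
by rewrite !moebius_scalar ?oner_eq0.
Qed.

Lemma conjugate_sym f g : conjugate f g -> conjugate g f.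
Proof.
move=> /conjugateP[a [b [c [d [D h]]]]]; apply/conjugateP.
exists d, (- b), (- c), a; split=> [|z]; first by rewrite mulrNN mulrC.
have D' : d * a - (- b) * (- c) != 0 by rewrite mulrNN mulrC.
have K' y := @moebius_adjK d (- b) (- c) a y D'; rewrite !opprK in K'.
by rewrite -{1}(K' z) -h moebius_adjK.
Qed.

Lemma conjugate_trans f g h : conjugate f g -> conjugate g h -> conjugate f h.
Proof.
move=> /conjugateP[a [b [c [d [D fg]]]]] /conjugateP[a' [b' [c' [d' [D' gh]]]]].
apply/conjugateP.
exists (a' * a + b' * c), (a' * b + b' * d), (c' * a + d' * c), (c' * b + d' * d).
split=> [|z]; last by rewrite -!moebius_comp // fg gh.
have := mulf_neq0 D' D; congr (_ != 0); ring.
Qed.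

Lemma conj_class_eq f g : conjugate f g -> conj_class f = conj_class g.
Proof.
move=> fg; apply/seteqP; split=> h /= fh.
  exact: conjugate_trans (conjugate_sym fg) fh.
exact: conjugate_trans fg fh.
Qed.

(** If [s p + t q = 1], then [h = s p' + t q'] satisfies [p' = h p] and [q' = h q]; dividing the
    coprime [p'] and [q'], it is a constant. *)
Lemma coprime_proportional p q p' q' : coprimep p q -> coprimep p' q' ->
  p' * q = q' * p -> exists2 k, k != 0 & p' = k *: p /\ q' = k *: q.
Proof.
move=> /Bezout_eq1_coprimepP[[s t] /= st] cpq' E.
pose h := s * p' + t * q'.
have hp : p' = h * p.
  by rewrite -[LHS]mulr1 -st /h; transitivity (s * p' * p + t * (p' * q)); [ring | rewrite E; ring].
have hq : q' = h * q.
  by rewrite -[LHS]mulr1 -st /h; transitivity (s * (q' * p) + t * q' * q); [ring | rewrite -E; ring].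
have /size_poly1P[k k0 hk] : size h == 1%N.
  rewrite size_poly_eq1; apply: (coprimepP _ _ cpq'); rewrite ?hp ?hq dvdp_mulIl //.
by exists k => //; rewrite -!mul_polyC -hk.
Qed.

Definition lift_conjugate n (f g : ratmap K) a b c d k := forall u v,
  homog n (rnum g) (a * u + b * v) (c * u + d * v) =
    k * (a * homog n (rnum f) u v + b * homog n (rden f) u v) /\
  homog n (rden g) (a * u + b * v) (c * u + d * v) =
    k * (c * homog n (rnum f) u v + d * homog n (rden f) u v).

(** Composing the lifts with the linear map on either side yields two pairs of forms for the same
    map. Restricted to [v = 1] they are coprime pairs, hence proportional by a constant [k], and
    this extends to all [(u, v)]. *)
Lemma conjugate_lift n f g : (0 < n)%N -> rdegree f = n -> rdegree g = n ->
  conjugate f g <-> exists a b c d k,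
    [/\ a * d - b * c != 0, k != 0 & lift_conjugate n f g a b c d k].
Proof.
move=> n0 df dg; rewrite conjugateP; split; last first.
  move=> [a [b [c [d [k [D k0 h]]]]]]; exists a, b, c, d; split=> // z.
  rewrite reval_rep moebius_proj ?nonzero_form ?nonzero_rep //.
  rewrite /moebius reval_form ?nonzero_mul ?nonzero_rep //.
  have [h1 h2] := h (rep z).1 (rep z).2.
  by rewrite /fnum /fden df dg h1 h2 proj_pt_scale.
move=> [a [b [c [d [D h]]]]]; exists a, b, c, d.
have szn := size_rnum g; have szd := size_rden g; rewrite dg in szn szd.
pose p := a *: rnum f + b *: rden f; pose q := c *: rnum f + d *: rden f.
have pE u v : homog n p u v = a * fnum f u v + b * fden f u v.
  by rewrite homD !homZ -df.
have qE u v : homog n q u v = c * fnum f u v + d * fden f u v.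
  by rewrite homD !homZ -df.
have szpq (s t : K) : (size (s *: rnum f + t *: rden f)%R <= n.+1)%N.
  rewrite (leq_trans (size_polyD _ _)) // geq_max -df.
  by rewrite !(leq_trans (size_scale_leq _ _)) ?size_rnum ?size_rden.
pose p' := hom_subst n (rnum g) (a *: 'X + b%:P) (c *: 'X + d%:P).
pose q' := hom_subst n (rden g) (a *: 'X + b%:P) (c *: 'X + d%:P).
have p'E u v : homog n p' u v = fnum g (a * u + b * v) (c * u + d * v).
  by rewrite hom_hom_subst // /fnum dg.
have q'E u v : homog n q' u v = fden g (a * u + b * v) (c * u + d * v).
  by rewrite hom_hom_subst // /fden dg.
have hx (r : {poly K}) x : (size r <= n.+1)%N -> homog n r x 1 = r.[x] by exact: hom_x1.
have p'x x : p'.[x] = fnum g (a * x + b) (c * x + d).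
  by rewrite horner_hom_subst !(hornerD, hornerZ, hornerX, hornerC) /fnum dg.
have q'x x : q'.[x] = fden g (a * x + b) (c * x + d).
  by rewrite horner_hom_subst !(hornerD, hornerZ, hornerX, hornerC) /fden dg.
have nz1 x : nonzero x 1 by rewrite /nonzero oner_eq0 orbT.
have [|||k k0 [pk qk]] := @coprime_proportional p q p' q'.
- apply/Pdiv.ClosedField.coprimepP => x /eqP px.
  have := nonzero_mul D (nonzero_form f (nz1 x)).
  by rewrite -pE -qE !hx ?szpq // /nonzero px eqxx.
- apply/Pdiv.ClosedField.coprimepP => x /eqP px.
  have := nonzero_form g (nonzero_mul D (nz1 x)).
  by rewrite mulr1 mulr1 -p'x -q'x /nonzero px eqxx.
- apply: poly_eq_fun => x; have := h (proj_pt x 1).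
  rewrite !(moebius_proj D, reval_form) ?nonzero_form ?nonzero_mul //.
  move=> /esym/proj_pt_eq; rewrite ?nonzero_form ?nonzero_mul ?nonzero_form // => /(_ isT isT).
  by rewrite -pE -qE !hx ?szpq // !mulr1 -p'x -q'x !hornerM => ->; rewrite mulrC.
exists k; split=> // u v; split.
  by have := p'E u v; rewrite pk homZ pE /fnum /fden dg df => ->.
by have := q'E u v; rewrite qk homZ qE /fnum /fden dg df => ->.
Qed.

(** The derivative at [x = 0] of the hypothesis, which is an identity along the line through
    [(u, v)] with direction [(s, t)]. *)
Lemma hom_subst_deriv_eq n (p q q1 : {poly K}) a b c d s t u v s' t' :
  (forall x, homog n p (a * (u + s * x) + b * (v + t * x)) (c * (u + s * x) + d * (v + t * x)) =
     s' * homog n q (u + s * x) (v + t * x) + t' * homog n q1 (u + s * x) (v + t * x)) ->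
  hom_du n p (a * u + b * v) (c * u + d * v) * (a * s + b * t) +
  hom_dv n p (a * u + b * v) (c * u + d * v) * (c * s + d * t) =
  s' * (hom_du n q u v * s + hom_dv n q u v * t) +
  t' * (hom_du n q1 u v * s + hom_dv n q1 u v * t).
Proof.
move=> h.
have line (w r : K) : exists2 U : {poly K}, forall x, U.[x] = w + r * x & U^`() = r%:P.
  exists (w%:P + r *: 'X) => [x|].
    by rewrite !(hornerD, hornerZ, hornerX, hornerC).
  by rewrite derivD derivC derivZ derivX add0r alg_polyC.
have [U hU dU] := line u s; have [V hV dV] := line v t.
have : hom_subst n p (a *: U + b *: V) (c *: U + d *: V) =
    s' *: hom_subst n q U V + t' *: hom_subst n q1 U V.
  apply: poly_eq_fun => x.
  by rewrite !(hornerD, hornerZ, horner_hom_subst) hU hV h.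
move/(congr1 (fun r : {poly K} => r^`().[0])).
rewrite !(derivD, derivZ) !(hornerD, hornerZ, deriv_hom_subst) !(derivD, derivZ) dU dV.
by rewrite !(hornerD, hornerZ, hornerC) hU hV !mulr0 !addr0.
Qed.

(** Differentiating the conjugacy of lifts in the two coordinate directions and taking determinants
    gives this identity multiplied by [a d - b c]. *)
Lemma jac_conjugate n f g a b c d k u v : a * d - b * c != 0 ->
  lift_conjugate n f g a b c d k ->
  jac n (rnum g) (rden g) (a * u + b * v) (c * u + d * v) =
  k ^+ 2 * jac n (rnum f) (rden f) u v.
Proof.
move=> D h; apply: (mulfI D); rewrite /jac.
have hn s t x : homog n (rnum g) (a * (u + s * x) + b * (v + t * x)) (c * (u + s * x) + d * (v + t * x)) =
    (k * a) * homog n (rnum f) (u + s * x) (v + t * x) + (k * b) * homog n (rden f) (u + s * x) (v + t * x).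
  by rewrite (h _ _).1; ring.
have hd s t x : homog n (rden g) (a * (u + s * x) + b * (v + t * x)) (c * (u + s * x) + d * (v + t * x)) =
    (k * c) * homog n (rnum f) (u + s * x) (v + t * x) + (k * d) * homog n (rden f) (u + s * x) (v + t * x).
  by rewrite (h _ _).2; ring.
have := hom_subst_deriv_eq (hn 1 0); have := hom_subst_deriv_eq (hn 0 1).
have := hom_subst_deriv_eq (hd 1 0); have := hom_subst_deriv_eq (hd 0 1).
set gu := hom_du n (rnum g) _ _; set gv := hom_dv n (rnum g) _ _.
set gu' := hom_du n (rden g) _ _; set gv' := hom_dv n (rden g) _ _.
set fu := hom_du n (rnum f) _ _; set fv := hom_dv n (rnum f) _ _.
set fu' := hom_du n (rden f) _ _; set fv' := hom_dv n (rden f) _ _.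
rewrite !mulr0 !mulr1 !addr0 !add0r => E1 E2 E3 E4.
transitivity ((gu * a + gv * c) * (gu' * b + gv' * d) -
              (gu * b + gv * d) * (gu' * a + gv' * c)); first by ring.
by rewrite E1 E2 E3 E4; ring.
Qed.

(** The linear map carries an eigenvector of eigenvalue [e] to one of eigenvalue [k e], and the
    Jacobian is multiplied by [k ^ 2], as [multiplier_form] requires. *)
Lemma multiplier_conjugate f g lam : (0 < rdegree f)%N -> rdegree g = rdegree f ->
  conjugate f g -> has_fixed_point_of_multiplier f lam ->
  has_fixed_point_of_multiplier g lam.
Proof.
move=> n0 dg /(conjugate_lift n0 erefl dg)[a [b [c [d [k [D k0 h]]]]]].
move=> /(multiplier_form _ n0)[u [v [e [nz e0 En Ed Ej]]]].
apply/multiplier_form; rewrite dg //.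
exists (a * u + b * v), (c * u + d * v), (k * e); split.
- exact: nonzero_mul.
- exact: mulf_neq0.
- by rewrite /fnum dg (h _ _).1 -/(fnum _ _ _) -/(fden _ _ _) En Ed; ring.
- by rewrite /fden dg (h _ _).2 -/(fnum _ _ _) -/(fden _ _ _) En Ed; ring.
- by rewrite /fjac dg (jac_conjugate _ _ D h) -/(fjac _ _ _) Ej; ring.
Qed.

(** The lift of [g] is built with the adjugate matrix in place of the inverse, which accounts for
    the factor [k = (a d - b c) ^ n]. *)
Lemma conjugate_exists f a b c d : (0 < rdegree f)%N -> a * d - b * c != 0 ->
  exists g k, [/\ rdegree g = rdegree f, k != 0
    & lift_conjugate (rdegree f) f g a b c d k].
Proof.
set n := rdegree f => n0 D.
pose p' := hom_subst n (rnum f) (d *: 'X + (- b)%:P) ((- c) *: 'X + a%:P).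
pose q' := hom_subst n (rden f) (d *: 'X + (- b)%:P) ((- c) *: 'X + a%:P).
have szl (r : {poly K}) : (size (hom_subst n r (d *: 'X + (- b)%:P) ((- c) *: 'X + a%:P)) <= n.+1)%N.
  exact: size_hom_subst_lin.
have D' : d * a - (- b) * (- c) != 0 by rewrite mulrNN mulrC.
pose p := a *: p' + b *: q'; pose q := c *: p' + d *: q'.
have szpq (s t : K) : (size (s *: p' + t *: q')%R <= n.+1)%N.
  rewrite (leq_trans (size_polyD _ _)) // geq_max.
  by rewrite !(leq_trans (size_scale_leq _ _)) ?szl.
have E u v : homog n p u v = a * fnum f (d * u + - b * v) (- c * u + a * v) +
     b * fden f (d * u + - b * v) (- c * u + a * v).
  by rewrite homD !homZ !hom_hom_subst ?size_rnum ?size_rden.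
have E' u v : homog n q u v = c * fnum f (d * u + - b * v) (- c * u + a * v) +
     d * fden f (d * u + - b * v) (- c * u + a * v).
  by rewrite homD !homZ !hom_hom_subst ?size_rnum ?size_rden.
have [|g [gn gd dg]] := ratmap_of_forms n0 (szpq a b) (szpq c d).
  by move=> u v nz; rewrite E E' nonzero_mul ?nonzero_form ?nonzero_mul.
exists g, ((a * d - b * c) ^+ n); split=> //; first exact: expf_neq0.
move=> u v; rewrite gn gd -/p -/q E E'.
have -> : d * (a * u + b * v) + - b * (c * u + d * v) = (a * d - b * c) * u by ring.
have -> : - c * (a * u + b * v) + a * (c * u + d * v) = (a * d - b * c) * v by ring.
by rewrite fnum_scale fden_scale -/n /fnum /fden -/n; split; ring.
Qed.

End MoebiusConjugacy.

(** * Normal forms of bicritical maps *)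

Section NormalForms.
Variable K : numClosedFieldType.
Implicit Types (f g : ratmap K) (u v a b c d k x : K) (z : sphere K).
Implicit Types (p q : {poly K}) (n : nat).

Lemma coef_mul_top p q i j : (size p <= i.+1)%N -> (size q <= j.+1)%N ->
  (p * q)`_(i + j) = p`_i * q`_j.
Proof.
move=> sp sq; have lti : (i < (i + j).+1)%N by rewrite ltnS leq_addr.
rewrite coefM (bigD1 (Ordinal lti)) //= addKn big1 ?addr0 // => -[l /= ltl] /eqP nli.
have [ltli|leil] := ltnP l i.
  rewrite [q`__]nth_default ?mulr0 //; apply: (leq_trans sq).
  by rewrite -addnBAC ?(ltnW ltli) // -[j.+1]add1n leq_add2r subn_gt0.
rewrite nth_default ?mul0r //; apply: (leq_trans sp).
rewrite ltn_neqAle leil andbT; apply/eqP => E; apply: nli; exact/val_inj.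
Qed.

Lemma size_deriv_leq p n : (size p <= n.+1)%N -> (size p^`() <= n)%N.
Proof.
by move=> sp; apply/leq_sizeP => i ni; rewrite coef_deriv nth_default ?mul0rn // (leq_trans sp).
Qed.

(** * Pairs of polynomials whose Wronskian has no root outside 0 *)

Section Wronskian.
Variables (n : nat) (p q : {poly K}).
Hypotheses (szp : (size p <= n.+1)%N) (szq : (size q <= n.+1)%N).
Let W := p^`() * q - p * q^`().
Hypothesis W_root : forall x, x != 0 -> W.[x] != 0.

Lemma wronskian_neq0 : W != 0.
Proof. by apply/eqP=> W0; have := W_root (oner_neq0 K); rewrite W0 horner0 eqxx. Qed.

(* Replacing one of the two maps by [a p - b q] only scales the Wronskian. *)
Lemma wronskian_pencil a b : nonzero a b ->
  let r := a *: p - b *: q in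
  r != 0 /\ exists h e, [/\ (h = p /\ e = b) \/ (h = q /\ e = a), e != 0
                          & e *: W = r^`() * h - r * h^`()].
Proof.
move=> nz r.
have Eq : a *: W = r^`() * q - r * q^`().
  by rewrite /r derivB !derivZ /W -!mul_polyC; ring.
have Ep : b *: W = r^`() * p - r * p^`().
  by rewrite /r derivB !derivZ /W -!mul_polyC; ring.
have he : exists h e, [/\ (h = p /\ e = b) \/ (h = q /\ e = a), e != 0
                          & e *: W = r^`() * h - r * h^`()].
  by case/orP: nz => e0; [exists q, a|exists p, b]; split=> //; [right|left].
split=> //; apply/eqP => r0; case: he => h [e [_ e0]].
rewrite r0 deriv0 !mul0r subrr => /eqP.
by rewrite scaler_eq0 (negbTE e0) (negbTE wronskian_neq0).
Qed.

(* [W] vanishes at 0 to order one less than [q(0) p - p(0) q], and its degree is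
   [n - 1] plus that of [q_n p - p_n q]; since it has no other root, it is a
   multiple of [X ^ (n - 1)]. *)
Lemma wronskian_binomial : (0 < n)%N -> nonzero p`_0 q`_0 -> nonzero p`_n q`_n ->
  p = p`_n *: 'X^n + (p`_0)%:P /\ q = q`_n *: 'X^n + (q`_0)%:P.
Proof.
move=> n_gt0 nz0 nzn.
have nzC a b : nonzero a b -> nonzero b a by rewrite /nonzero orbC.
(* Here [r = q_0 p - p_0 q] vanishes at 0, and [h] is one of [p], [q], with value [e != 0] at 0. *)
have [r_neq0 [h [e [he e0 hW]]]] := wronskian_pencil (nzC _ _ nz0).
set r := _ - _ in r_neq0 hW.
have [m [r1 /implyP/(_ r_neq0) r1_0 rE]] := multiplicity_XsubC r 0.
rewrite polyC0 subr0 in rE.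
have m_gt0 : (0 < m)%N.
  case: m rE => // rE; move: r1_0; rewrite expr0 mulr1 in rE.
  by rewrite -rE /root /r horner_coef0 coefB !coefZ mulrC subrr eqxx.
case: m m_gt0 rE => // k _ rE.
have he0 : h`_0 = e by case: he => -[-> ->].
(* The cofactor of [X ^ k] in [W], obtained from [r = r1 X ^ (k + 1)]. Its value at 0 is
   [(k + 1) r1(0)], so it has no root at all and is constant. *)
pose W1 := e^-1 *: ('X * r1^`() * h + k.+1%:R%:P * r1 * h - 'X * r1 * h^`()).
have WE : W = W1 * 'X^k.
  rewrite -[W]scale1r -(mulVf e0) -scalerA hW rE derivM derivXn /= -mulr_natl -polyC_natr.
  by rewrite /W1 -!mul_polyC exprS; ring.
have W1_0 : W1.[0] != 0.
  rewrite /W1 hornerZ !(hornerD, hornerN, hornerM) hornerX hornerC !mul0r subr0 add0r.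
  by rewrite [h.[0]]horner_coef0 he0 !mulf_neq0 ?invr_neq0 ?pnatr_eq0.
have /eqP szW1 : size W1 == 1%N.
  apply/negPn/negP => /closed_rootP[x x0].
  have [E|/W_root] := eqVneq x 0; first by rewrite E in x0; rewrite (eqP x0) eqxx in W1_0.
  by rewrite WE hornerM (eqP x0) mul0r eqxx.
have W1_neq0 : W1 != 0 by rewrite -size_poly_eq0 szW1.
have szW : size W = k.+1 by rewrite WE size_mulXn // szW1 addn1.
have r1_neq0 : r1 != 0 by apply: contraNneq r1_0 => ->; rewrite root0.
have szr : (size r1 + k <= n)%N.
  rewrite -ltnS -addnS addnC -size_mulXn // -rE (leq_trans (size_polyD _ _)) //.
  by rewrite geq_max size_polyN !(leq_trans (size_scale_leq _ _)).
(* The same at infinity: [s = q_n p - p_n q] has degree [m < n] because its coefficient of [X ^ n]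
   cancels, while [h'] has degree [n] and leading coefficient [e']. *)
have [s_neq0 [h' [e' [he' e'0 hW']]]] := wronskian_pencil (nzC _ _ nzn).
set s := _ - _ in s_neq0 hW'.
pose m := (size s).-1; have szs : size s = m.+1 by rewrite prednK ?size_poly_gt0.
have hn' : h'`_n = e' by case: he' => -[-> ->].
have szh' : (size h' <= n.+1)%N by case: he' => -[-> _].
have sn : s`_n = 0 by rewrite /s coefB !coefZ mulrC subrr.
have szs_le : (size s <= n.+1)%N.
  rewrite (leq_trans (size_polyD _ _)) //.
  by rewrite geq_max size_polyN !(leq_trans (size_scale_leq _ _)).
have lem : (m < n)%N.
  rewrite -szs; move: szs_le; rewrite leq_eqVlt => /orP[/eqP E|//].
  by move/eqP: sn; rewrite -[n]/(n.+1.-1) -E -lead_coefE lead_coef_eq0 (negbTE s_neq0).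
(* This coefficient is [(m - n) s_m e']. *)
have top : (e' *: W)`_(m + n.-1) != 0.
  have sm : s`_m != 0 by rewrite -lead_coefE lead_coef_eq0.
  have Esh : (s * h'^`())`_(m + n.-1) = n%:R * s`_m * e'.
    rewrite coef_mul_top ?szs //.
      by rewrite coef_deriv prednK // hn' -[e' *+ _]mulr_natr; ring.
    by rewrite prednK // size_deriv_leq.
  have Es'h : (s^`() * h')`_(m + n.-1) = m%:R * s`_m * e'.
    case: (m) szs (erefl m) => [|i] szs' mE.
      by move/eqP: szs' => /size_poly1P[w _ ->]; rewrite derivC mul0r coef0 !mul0r.
    rewrite addSnnS prednK // coef_mul_top //.
      by rewrite hn' coef_deriv -[s`__ *+ _]mulr_natl.
    by rewrite size_deriv_leq // szs'.
  rewrite hW' coefB Esh Es'h -mulrBl -mulrBl !mulf_neq0 // subr_eq0 eqr_nat.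
  by rewrite neq_ltn lem.
(* Together with [k + 1 <= n], which comes from the size of [r], this forces [m = 0], [k = n - 1]
   and [r1] constant. *)
have mk : (m + n.-1 <= k)%N.
  rewrite -ltnS -szW ltnNge; apply: contra top => h1.
  by rewrite coefZ [W`__]nth_default ?mulr0.
have r1_gt0 : (0 < size r1)%N by rewrite size_poly_gt0.
have kn : k.+1 = n.
  apply/eqP; rewrite eqn_leq; apply/andP; split.
    by apply: leq_trans szr; rewrite -add1n leq_add2r.
  by rewrite -(prednK n_gt0) ltnS (leq_trans _ mk) // leq_addl.
have m0 : m = 0%N.
  by move: mk; rewrite -{1}kn /= -{2}[k]add0n leq_add2r leqn0 => /eqP.
have /size_poly1P[w w0 r1w] : size r1 == 1%N.
  by rewrite eqn_leq r1_gt0 andbT -(leq_add2r k) add1n kn.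
have ri i : (0 < i < n)%N -> r`_i = 0.
  move=> /andP[i0 ilt]; rewrite rE r1w mul_polyC coefZ coefXn kn.
  by rewrite (ltn_eqF ilt) mulr0.
have si i : (0 < i < n)%N -> s`_i = 0.
  by move=> /andP[i0 _]; rewrite nth_default // szs m0.
have rn : r`_n != 0 by rewrite rE r1w mul_polyC coefZ coefXn kn eqxx mulr1.
(* The combinations [r] and [s] of [p] and [q] have determinant [- r_n], which is nonzero, so [p]
   and [q] lack the middle coefficients too. *)
have pq i : (0 < i < n)%N -> p`_i = 0 /\ q`_i = 0.
  move=> ilt; have := ri _ ilt; have := si _ ilt; move: rn.
  rewrite /r /s !coefB !coefZ => rn /eqP; rewrite subr_eq0 => /eqP E1 /eqP.
  rewrite subr_eq0 => /eqP E2; split; apply: (mulfI rn); rewrite mulr0.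
    transitivity (p`_n * (q`_0 * p`_i) - p`_0 * (q`_n * p`_i)); first by ring.
    by rewrite E1 E2; ring.
  transitivity (q`_0 * (p`_n * q`_i) - q`_n * (p`_0 * q`_i)); first by ring.
  by rewrite -E1 -E2; ring.
have fin (l : {poly K}) : (size l <= n.+1)%N -> (forall i, (0 < i < n)%N -> l`_i = 0) ->
    l = l`_n *: 'X^n + (l`_0)%:P.
  move=> szl li; apply/polyP => i; rewrite coefD coefZ coefXn coefC.
  case: (ltngtP i n) => [ltin|ltni|->].
  - rewrite mulr0 add0r; case: eqP => [->//|/eqP i0]; rewrite li // ltin lt0n i0 //.
  - rewrite nth_default ?(leq_trans szl) // mulr0 add0r.
    by rewrite gtn_eqF // (leq_ltn_trans _ ltni).
  - by rewrite mulr1 gtn_eqF // addr0.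
by split; apply: fin => // i /pq[].
Qed.

End Wronskian.

(** * Degree, Jacobian and critical points of a normal form *)

Lemma coef_binomial n a b i :
  (a *: 'X^n + b%:P)`_i = a * (i == n)%:R + b * (i == 0%N)%:R.
Proof.
by rewrite coefD coefZ coefXn coefC; case: (i == 0%N); rewrite ?mulr1 ?mulr0.
Qed.

Lemma size_binomial n a b : (size (a *: 'X^n + b%:P)%R <= n.+1)%N.
Proof.
apply/leq_sizeP => i lti; rewrite coef_binomial (gtn_eqF lti).
by rewrite gtn_eqF ?(leq_ltn_trans _ lti) // !mulr0 addr0.
Qed.

Lemma sum_binomial n a b (F : nat -> K) : (0 < n)%N ->
  \sum_(i < n.+1) (a *: 'X^n + b%:P)`_i * F i = a * F n + b * F 0%N.
Proof.
case: n => // n _; rewrite big_ord_recl big_ord_recr /= big1 => [|i _].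
  by rewrite !coef_binomial /= /bump /= add1n eqxx /=; ring.
rewrite coef_binomial /bump /= add1n eqSS (ltn_eqF (ltn_ord i)) mulr0n; ring.
Qed.

Lemma hom_binomial n a b u v : (0 < n)%N ->
  homog n (a *: 'X^n + b%:P) u v = a * u ^+ n + b * v ^+ n.
Proof.
move=> n0; rewrite /homog (sum_binomial _ _ (fun i => u ^+ i * v ^+ (n - i)%N)) //.
by rewrite subnn subn0 !expr0 mulr1 mul1r.
Qed.

Lemma jac_binomial n a b c d u v : (0 < n)%N ->
  jac n (a *: 'X^n + b%:P) (c *: 'X^n + d%:P) u v =
  n%:R ^+ 2 * (a * d - b * c) * (u * v) ^+ n.-1.
Proof.
move=> n0; rewrite /jac /hom_du /hom_dv.
rewrite !(sum_binomial _ _ (fun i => (i%:R * u ^+ i.-1) * v ^+ (n - i)%N)) //.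
rewrite !(sum_binomial _ _ (fun i => u ^+ i * ((n - i)%:R * v ^+ (n - i)%N.-1))) //.
by rewrite subnn subn0 !expr0 exprMn; ring.
Qed.

Lemma rdegree_normal_form n f a b c d : (0 < n)%N ->
  is_normal_form n f a b c d -> rdegree f = n.
Proof.
move=> n0 [D fn fd]; have ac : (a != 0) || (c != 0).
  rewrite -negb_and; apply: contra D => /andP[/eqP-> /eqP->].
  by rewrite mul0r mulr0 subrr.
suff -> : rdegree f = n.+1.-1 by [].
congr _.-1; apply/eqP; rewrite eqn_leq geq_max fn fd !size_binomial /= leq_max.
have top (s t : K) : s != 0 -> (n < size (s *: 'X^n + t%:P)%R)%N.
  move=> s0; rewrite ltnNge; apply: contra s0 => sz.
  have := coef_binomial n s t n; rewrite eqxx (gtn_eqF n0) nth_default //.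
  by rewrite mulr1 mulr0 addr0 => <-.
by case/orP: ac => /top h; rewrite h ?orbT.
Qed.

Lemma normal_form_exists n a b c d : (0 < n)%N -> a * d - b * c != 0 ->
  exists f, is_normal_form n f a b c d.
Proof.
move=> n0 D.
have [|f [fn fd _]] := ratmap_of_forms n0 (size_binomial n a b) (size_binomial n c d).
  move=> u v nz; rewrite !hom_binomial // nonzero_mul //.
  by move: nz; rewrite /nonzero !expf_eq0 n0.
by exists f.
Qed.

Lemma fjac_normal_form n f a b c d u v : (0 < n)%N -> is_normal_form n f a b c d ->
  fjac f u v = n%:R ^+ 2 * (a * d - b * c) * (u * v) ^+ n.-1.
Proof.
move=> n0 nf; rewrite /fjac (rdegree_normal_form n0 nf); case: nf => _ -> ->.
exact: jac_binomial.
Qed.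

Lemma fjac_normal_form_eq0 n f a b c d u v : (1 < n)%N -> is_normal_form n f a b c d ->
  (fjac f u v == 0) = (u * v == 0).
Proof.
move=> n1 nf; have n0 := ltnW n1; rewrite (fjac_normal_form _ _ n0 nf).
case: nf => D _ _; have nD : n%:R ^+ 2 * (a * d - b * c) != 0.
  by rewrite mulf_neq0 ?expf_neq0 ?pnatr_eq0 -?lt0n.
by rewrite mulf_eq0 (negbTE nD) expf_eq0 -ltnS prednK // n1.
Qed.

Lemma normal_form_bicritical n f a b c d : (1 < n)%N -> is_normal_form n f a b c d ->
  bicritical f.
Proof.
move=> n1 nf; have n0 := ltnW n1; exists (Some 0), None; split=> //.
have cr y := @critical_form K f (rep y).1 (rep y).2.
rewrite (rdegree_normal_form n0 nf) in cr.
apply/seteqP; split=> z.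
  rewrite -{1}(proj_pt_rep z) => /(cr z n0 (nonzero_rep z))/eqP.
  rewrite (fjac_normal_form_eq0 _ _ n1 nf); case: z => [x|] /=; last by right.
  by rewrite mulr1 => /eqP->; left.
move=> hz; rewrite -(proj_pt_rep z); apply/(cr z n0 (nonzero_rep z))/eqP.
by rewrite (fjac_normal_form_eq0 _ _ n1 nf); case: hz => -> /=; rewrite ?mul0r ?mulr0.
Qed.

(** The matrix with rows [(v1, - u1)] and [(v2, - u2)] moves [z1] to 0 and [z2] to infinity, after
    which [wronskian_binomial] applies. *)
Lemma bicritical_normal_form n f : (1 < n)%N -> rdegree f = n -> bicritical f ->
  exists g a b c d, conjugate f g /\ is_normal_form n g a b c d.
Proof.
move=> n1 df [z1 [z2 [z12 crit]]]; have n0 := ltnW n1.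
pose u1 := (rep z1).1; pose v1 := (rep z1).2.
pose u2 := (rep z2).1; pose v2 := (rep z2).2.
have D : v1 * - u2 - (- u1) * v2 != 0.
  apply/eqP => D; apply: z12; rewrite -(proj_pt_rep z1) -(proj_pt_rep z2).
  apply/proj_pt_eq; rewrite ?nonzero_rep // -/u1 -/u2 -/v1 -/v2.
  by apply/eqP; rewrite -subr_eq0 -D; apply/eqP; ring.
have f0 : (0 < rdegree f)%N by rewrite df.
have [g [k [dg k0 lfg]]] := conjugate_exists f0 D.
rewrite df in dg lfg.
have fg : conjugate f g.
  by apply/(conjugate_lift n0 df dg); exists v1, (- u1), v2, (- u2), k.
have n_neq0 : n%:R != 0 :> K by rewrite pnatr_eq0 -lt0n.
have W_root x : x != 0 -> ((rnum g)^`() * rden g - rnum g * (rden g)^`()).[x] != 0.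
  move=> x0; apply/eqP => Wx.
  have jx : fjac g x 1 = 0 by rewrite fjac_x1 Wx mulr0.
  (* The vector [(u, v)] is the preimage of [(x, 1)]. A root [x] of the Wronskian makes it a
     critical point of [f], hence [z1] or [z2], whose images are 0 and infinity. *)
  pose e := (v1 * - u2 - (- u1) * v2)^-1.
  pose u := e * (- u2 * x + u1); pose v := e * (- v2 * x + v1).
  have Ex : v1 * u + - u1 * v = x by rewrite /u /v /e; field.
  have E1 : v2 * u + - u2 * v = 1 by rewrite /u /v /e; field.
  have nz : nonzero u v.
    rewrite /nonzero -negb_and; apply/negP => /andP[/eqP u0 /eqP v0].
    by move/eqP: E1; rewrite u0 v0 !mulr0 addr0 eq_sym oner_eq0.
  have := jac_conjugate u v D lfg; rewrite Ex E1.
  have -> : jac n (rnum f) (rden f) u v = fjac f u v by rewrite /fjac df.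
  have -> : jac n (rnum g) (rden g) x 1 = fjac g x 1 by rewrite /fjac dg.
  rewrite jx => /esym/eqP; rewrite mulf_eq0 (negbTE (expf_neq0 _ k0)) /= => /eqP.
  move=> /(critical_form f0 nz); rewrite crit => -[].
    rewrite -(proj_pt_rep z1) => /(proj_pt_eq nz (nonzero_rep _)); rewrite -/u1 -/v1 => E.
    by move/eqP: x0; apply; rewrite -Ex mulNr -E mulrC subrr.
  rewrite -(proj_pt_rep z2) => /(proj_pt_eq nz (nonzero_rep _)); rewrite -/u2 -/v2 => E.
  by move/eqP: E1; rewrite mulNr -E mulrC subrr eq_sym oner_eq0.
have szn := size_rnum g; have szd := size_rden g; have top := nonzero_top g.
rewrite dg in szn szd top.
have bot : nonzero (rnum g)`_0 (rden g)`_0.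
  have := @nonzero_form K g 0 1; rewrite /nonzero oner_eq0 orbT => /(_ isT).
  by rewrite fnum_x1 fden_x1 !horner_coef0.
have [gn gd] := wronskian_binomial szn szd W_root n0 bot top.
exists g, (rnum g)`_n, (rnum g)`_0, (rden g)`_n, (rden g)`_0; split=> //; split=> //.
apply/eqP => D0; have := W_root 1 (oner_neq0 K).
have J := jac_binomial (rnum g)`_n (rnum g)`_0 (rden g)`_n (rden g)`_0 1 1 n0.
rewrite -gn -gd D0 mulr0 mul0r in J.
by rewrite -(mulrI_eq0 _ (mulfI n_neq0)) -{1}dg -fjac_x1 /fjac dg J eqxx.
Qed.

End NormalForms.

(** * The coordinates X and Y *)

Section ModuliCoordinates.
Variable K : numClosedFieldType.
Implicit Types (f g : ratmap K) (a b c d k x : K) (n m : nat).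

(* The linear map [diag (al, be)] conjugates the lift of the normal form
   [(a, b, c, d)] to that of [(a', b', c', d')], up to the factor [k]. *)
Definition diag_conj n al be k a b c d a' b' c' d' : Prop :=
  [/\ a' * al ^+ n = k * al * a, b' * be ^+ n = k * al * b,
      c' * al ^+ n = k * be * c & d' * be ^+ n = k * be * d].

(** Both [b c] and [a d - b c] are multiplied by the same factor [t], and each term in the numerator
    of [Y] by [t ^ (m + 1)]. *)
Lemma diag_conj_inv m al be k a b c d a' b' c' d' :
  al != 0 -> be != 0 -> k != 0 ->
  a * d - b * c != 0 ->
  diag_conj m.+1 al be k a b c d a' b' c' d' ->
  invX a' b' c' d' = invX a b c d /\ invY m.+1 a' b' c' d' = invY m.+1 a b c d.
Proof.
move=> al0 be0 k0 D [Ea Eb Ec Ed].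
have [A EA A0] : exists2 A, A = al ^+ m & A != 0 by exists (al ^+ m); rewrite ?expf_neq0.
have [B EB B0] : exists2 B, B = be ^+ m & B != 0 by exists (be ^+ m); rewrite ?expf_neq0.
have a'E : a' = k * a / A.
  by apply: (mulIf (expf_neq0 m.+1 al0)); rewrite Ea exprS -EA; field.
have b'E : b' = k * al * b / (be * B).
  by apply: (mulIf (expf_neq0 m.+1 be0)); rewrite Eb exprS -EB; field; apply/andP.
have c'E : c' = k * be * c / (al * A).
  by apply: (mulIf (expf_neq0 m.+1 al0)); rewrite Ec exprS -EA; field; apply/andP.
have d'E : d' = k * d / B.
  by apply: (mulIf (expf_neq0 m.+1 be0)); rewrite Ed exprS -EB; field.
pose t := k ^+ 2 / (A * B).
have t0 : t != 0 by rewrite mulf_neq0 ?invr_eq0 ?expf_neq0 ?mulf_neq0.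
have D'E : a' * d' - b' * c' = t * (a * d - b * c).
  by rewrite a'E b'E c'E d'E /t; field; rewrite al0 be0 A0 B0.
have bcE : b' * c' = t * (b * c).
  by rewrite b'E c'E /t; field; rewrite al0 be0 A0 B0.
have split2 (p q : K) : p ^+ m.+2 * q ^+ m = (p * q) ^+ m * p ^+ 2.
  by rewrite exprMn -addn2 exprD; ring.
have abE : a' ^+ m.+2 * b' ^+ m = t ^+ m.+1 * (a ^+ m.+2 * b ^+ m).
  rewrite !split2 [a' * b'](_ : _ = t * (a * b) * (al / be)); last first.
    by rewrite a'E b'E /t; field; rewrite be0 A0 B0.
  rewrite exprMn [(al / be) ^+ m]exprMn exprVn -EA -EB a'E exprMn [t ^+ m.+1]exprS /t.
  by field; rewrite A0 B0.
have cdE : c' ^+ m * d' ^+ m.+2 = t ^+ m.+1 * (c ^+ m * d ^+ m.+2).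
  rewrite [LHS]mulrC [c ^+ m * _]mulrC !split2 [d' * c'](_ : _ = t * (d * c) * (be / al)); last first.
    by rewrite d'E c'E /t; field; rewrite al0 A0 B0.
  rewrite exprMn [(be / al) ^+ m]exprMn exprVn -EA -EB d'E exprMn [t ^+ m.+1]exprS /t.
  by field; rewrite A0 B0.
rewrite /invX /invY /= D'E bcE abE cdE -mulrDr [(t * _) ^+ _]exprMn.
have cancel (r x y : K) : r != 0 -> r * x / (r * y) = x / y.
  by move=> r0; rewrite -mulf_div divff // mul1r.
by rewrite !cancel ?expf_neq0.
Qed.

Lemma invX_swap a b c d : invX d c b a = invX a b c d.
Proof. by rewrite /invX [c * b]mulrC [d * a]mulrC. Qed.

Lemma invY_swap n a b c d : invY n d c b a = invY n a b c d.
Proof.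
rewrite /invY [c * b]mulrC [d * a]mulrC addrC; congr ((_ + _) / _); exact: mulrC.
Qed.

(* A conjugacy between normal forms preserves the set [{0, infinity}] of
   critical points, so that its matrix is diagonal or antidiagonal. *)
Lemma normal_form_inv n f g a b c d a' b' c' d' : (1 < n)%N ->
  is_normal_form n f a b c d -> is_normal_form n g a' b' c' d' -> conjugate f g ->
  invX a' b' c' d' = invX a b c d /\ invY n a' b' c' d' = invY n a b c d.
Proof.
move=> n1 nf ng; have n0 := ltnW n1.
have df := rdegree_normal_form n0 nf; have dg := rdegree_normal_form n0 ng.
move=> /(conjugate_lift n0 df dg)[al [be [ga [de [k [D k0 h]]]]]].
have jz u v : u * v = 0 -> (al * u + be * v) * (ga * u + de * v) = 0.
  move=> /eqP uv0; apply/eqP; rewrite -(fjac_normal_form_eq0 _ _ n1 ng) /fjac dg.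
  rewrite (jac_conjugate _ _ D h) mulf_eq0 -{1}df -/(fjac f u v).
  by rewrite (fjac_normal_form_eq0 _ _ n1 nf) uv0 orbT.
have := jz 1 0; rewrite !mulr0 !mulr1 !addr0 => /(_ erefl) ag.
have := jz 0 1; rewrite mul0r !mulr0 !mulr1 !add0r => /(_ erefl) bd.
have [Df fn fd] := nf; have [Dg gn gd] := ng.
have E u v : a' * (al * u + be * v) ^+ n + b' * (ga * u + de * v) ^+ n =
    k * (al * (a * u ^+ n + b * v ^+ n) + be * (c * u ^+ n + d * v ^+ n)) /\
    c' * (al * u + be * v) ^+ n + d' * (ga * u + de * v) ^+ n =
    k * (ga * (a * u ^+ n + b * v ^+ n) + de * (c * u ^+ n + d * v ^+ n)).
  by have := h u v; rewrite gn gd fn fd !hom_binomial.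
have [E1 E2] := E 1 0; have [E3 E4] := E 0 1; move: E1 E2 E3 E4.
have z0 : 0 ^+ n = 0 :> K by rewrite expr0n (gtn_eqF n0).
rewrite !mulr0 !mulr1 !addr0 !add0r !expr1n !z0 !mulr0 !mulr1 !addr0 !add0r => E1 E2 E3 E4.
case: n n1 n0 nf ng df dg h jz gn gd fn fd E z0 E1 E2 E3 E4 => // m _ _ _ _ _ _ _ _ _ _ _ _ _ z0 E1 E2 E3 E4.
move/eqP: ag; rewrite mulf_eq0 => /orP[] /eqP z.
  move: D; rewrite z mul0r sub0r oppr_eq0 mulf_eq0 negb_or => /andP[be0 ga0].
  move/eqP: bd; rewrite mulf_eq0 (negbTE be0) => /eqP de0.
  (* In the antidiagonal case the two coordinates are exchanged first, which turns [(a, b, c, d)]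
     into [(d, c, b, a)]. *)
  rewrite -(invX_swap a) -(invY_swap _ a); apply: (@diag_conj_inv _ be ga k) => //.
    by rewrite mulrC [c * b]mulrC.
  move: E1 E2 E3 E4; rewrite z de0 z0 !mul0r !mulr0 !addr0 !add0r => E1 E2 E3 E4.
  by split; rewrite ?E1 ?E2 ?E3 ?E4 mulrA.
move: D; rewrite z mulr0 subr0 mulf_eq0 negb_or => /andP[al0 de0].
move/eqP: bd; rewrite mulf_eq0 (negbTE de0) orbF => /eqP be0.
apply: (@diag_conj_inv _ al de k) => //.
move: E1 E2 E3 E4; rewrite z be0 z0 !mul0r !mulr0 !addr0 !add0r => E1 E2 E3 E4.
by split; rewrite ?E1 ?E2 ?E3 ?E4 mulrA.
Qed.

(** Take [al ^ 2 = a' b' / (a b)] and solve the first equation for [k]. The remaining ones then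
    involve [A = al ^ m] at most through [A ^ 2], which the last hypothesis identifies with
    [(a / a') ^ 2]; either square root will do. *)
Lemma diag_conj_exists_ab m a b c d a' b' c' d' :
  a != 0 -> b != 0 -> a' != 0 -> b' != 0 ->
  b' * c' = b * c -> a' * d' = a * d ->
  a' ^+ m.+2 * b' ^+ m = a ^+ m.+2 * b ^+ m ->
  exists al k, [/\ al != 0, k != 0 & diag_conj m.+1 al al^-1 k a b c d a' b' c' d'].
Proof.
move=> a0 b0 a'0 b'0 bc ad ab.
have [al al2] : exists al, al ^+ 2 = b' * a' / (a * b).
  by exists (sqrtC (b' * a' / (a * b))); rewrite sqrtCK.
have al0 : al != 0.
  by rewrite -sqrf_eq0 al2 mulf_neq0 ?invr_eq0 ?mulf_neq0.
have [A EA] : exists A, A = al ^+ m by exists (al ^+ m).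
have A0 : A != 0 by rewrite EA expf_neq0.
have A2 : A ^+ 2 = (a / a') ^+ 2.
  have -> : A ^+ 2 = (b' * a' / (a * b)) ^+ m by rewrite EA -al2 -!exprM mulnC.
  rewrite !exprMn exprVn !exprMn; set p := b' ^+ m; set q := a ^+ m.
  have pow2 (x : K) : x ^+ m.+2 = x ^+ m * x ^+ 2 by rewrite -addn2 exprD.
  move: ab; rewrite !pow2 -/p -/q => ab.
  have p0 : p != 0 by rewrite expf_neq0.
  have q0 : q != 0 by rewrite expf_neq0.
  have r0 : b ^+ m != 0 by rewrite expf_neq0.
  apply: (mulIf (mulf_neq0 (mulf_neq0 q0 r0) (expf_neq0 2 a'0))).
  transitivity (a' ^+ m * a' ^+ 2 * p); first by field; rewrite q0 r0.
  by rewrite ab; field.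
exists al, (A * a' / a); split; rewrite ?mulf_neq0 ?invr_eq0 //.
have Vn i : al^-1 ^+ i = (al ^+ i)^-1 by rewrite exprVn.
split; rewrite ?Vn exprS -EA.
- by field.
- apply: (mulIf (mulf_neq0 al0 A0)).
  transitivity b'; first by field; rewrite al0 A0.
  transitivity (A ^+ 2 * al ^+ 2 * a' * b / a); last by field.
  by rewrite A2 al2; field; rewrite a0 b0 a'0.
- apply: (mulIf al0); transitivity (c' * al ^+ 2 * A); first by ring.
  rewrite al2; transitivity (b' * c' * a' / (a * b) * A); first by field; rewrite a0 b0.
  by rewrite bc; field; rewrite a0 al0 b0.
- apply: (mulIf (mulf_neq0 al0 A0)).
  transitivity d'; first by field; rewrite al0 A0.
  transitivity (A ^+ 2 * a' * d / a); last by field; rewrite al0 a0.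
  rewrite A2; apply: (mulfI a'0); rewrite ad; field; rewrite a0 a'0 //.
Qed.

(** If [a b] or [c d] is nonzero, [diag_conj_exists_ab] applies, in the second case with the
    coordinates exchanged. Otherwise both matrices are antidiagonal or both diagonal, and a root of
    order [m + 2] or [m] supplies [al]. *)
Lemma diag_conj_exists_det1 m a b c d a' b' c' d' : (0 < m)%N ->
  a * d - b * c = 1 -> a' * d' - b' * c' = 1 -> b' * c' = b * c ->
  a' ^+ m.+2 * b' ^+ m = a ^+ m.+2 * b ^+ m ->
  c' ^+ m * d' ^+ m.+2 = c ^+ m * d ^+ m.+2 ->
  exists al be k, [/\ al != 0, be != 0, k != 0
    & diag_conj m.+1 al be k a b c d a' b' c' d'].
Proof.
move=> m0 D D' bc ab cd.
have ad : a' * d' = a * d by rewrite -[LHS](subrK (b' * c')) D' -D bc subrK.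
have pw0 (p q : K) : (p ^+ m.+2 * q ^+ m == 0) = (p == 0) || (q == 0).
  by rewrite mulf_eq0 !expf_eq0 /= m0.
have ab0 : (a' == 0) || (b' == 0) = (a == 0) || (b == 0) by rewrite -!pw0 ab.
have cd0 : (d' == 0) || (c' == 0) = (d == 0) || (c == 0) by rewrite -!pw0 !(mulrC (_ ^+ m.+2)) cd.
case: (boolP ((a == 0) || (b == 0))) => [ab_0|]; last first.
  move=> nab; move: (nab) (nab); rewrite -{1}ab0 !negb_or => /andP[a'0 b'0] /andP[a0 b0].
  have [al [k [al0 k0 h]]] := diag_conj_exists_ab a0 b0 a'0 b'0 bc ad ab.
  by exists al, al^-1, k; rewrite invr_eq0.
case: (boolP ((d == 0) || (c == 0))) => [cd_0|]; last first.
  move=> ncd; move: (ncd) (ncd); rewrite -{1}cd0 !negb_or => /andP[d'0 c'0] /andP[d0 c0].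
  have [|||al [k [al0 k0 [h1 h2 h3 h4]]]] := @diag_conj_exists_ab m d c b a d' c' b' a' d0 c0 d'0 c'0.
  - by rewrite mulrC bc mulrC.
  - by rewrite mulrC ad mulrC.
  - by rewrite mulrC cd mulrC.
  by exists al^-1, al, k; rewrite invr_eq0.
have [a0|a0] := eqVneq a 0.
  have bcN : b * c = -1 by rewrite -D a0; ring.
  have b0 : b != 0 by apply: contra_eq_neq bcN => ->; rewrite mul0r eq_sym oppr_eq0 oner_eq0.
  have c0 : c != 0 by apply: contra_eq_neq bcN => ->; rewrite mulr0 eq_sym oppr_eq0 oner_eq0.
  have b'0 : b' != 0 by apply: contra_eq_neq bcN; rewrite -bc => ->; rewrite mul0r eq_sym oppr_eq0 oner_eq0.
  have c'0 : c' != 0 by apply: contra_eq_neq bcN; rewrite -bc => ->; rewrite mulr0 eq_sym oppr_eq0 oner_eq0.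
  have d0 : d = 0 by move: cd_0; rewrite (negbTE c0) orbF => /eqP.
  have a'0 : a' = 0 by move: ab0; rewrite a0 eqxx (negbTE b'0) orbF => /eqP.
  have d'0 : d' = 0 by move: cd0; rewrite d0 eqxx (negbTE c'0) orbF => /eqP.
  pose al := (m.+2).-root (b' / b); have alE : al ^+ m.+2 = b' / b by rewrite rootCK.
  have al0 : al != 0 by apply: contra_eq_neq alE => ->; rewrite expr0n eq_sym mulf_neq0 ?invr_eq0.
  exists al, al^-1, 1; rewrite invr_eq0 oner_eq0; split=> //.
  have P0 : al ^+ m.+1 != 0 by rewrite expf_neq0.
  split; rewrite ?a0 ?d0 ?a'0 ?d'0 ?(mulr0, mul0r) // ?exprVn mul1r.
    apply: (mulIf P0); rewrite divfK // mulrAC -exprS alE; by field.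
  apply: (mulfI al0); rewrite mulrCA -exprS alE mulVKf //.
  by apply: (mulIf b0); rewrite mulrA divfK // [c' * _]mulrC bc mulrC.
have b0 : b = 0 by move: ab_0; rewrite (negbTE a0) => /eqP.
have ad1 : a * d = 1 by rewrite -D b0 mul0r subr0.
have d0 : d != 0 by apply: contra_eq_neq ad1 => ->; rewrite mulr0 eq_sym oner_eq0.
have c0 : c = 0 by move: cd_0; rewrite (negbTE d0) => /eqP.
have a'0 : a' != 0 by apply: contra_eq_neq ad1; rewrite -ad => ->; rewrite mul0r eq_sym oner_eq0.
have d'0 : d' != 0 by apply: contra_eq_neq ad1; rewrite -ad => ->; rewrite mulr0 eq_sym oner_eq0.
have b'0 : b' = 0 by move: ab0; rewrite b0 eqxx orbT (negbTE a'0) => /eqP.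
have c'0 : c' = 0 by move: cd0; rewrite c0 eqxx orbT (negbTE d'0) => /eqP.
pose al := m.-root (a / a'); have alE : al ^+ m = a / a' by rewrite rootCK.
have al0 : al != 0 by apply: contra_eq_neq alE => ->; rewrite expr0n (gtn_eqF m0) eq_sym mulf_neq0 ?invr_eq0.
exists al, al^-1, 1; rewrite invr_eq0 oner_eq0; split=> //.
split; rewrite ?b0 ?c0 ?b'0 ?c'0 ?(mulr0, mul0r) // ?exprVn mul1r exprS alE.
  by field.
rewrite invfM invf_div mulrCA; congr (_ * _).
by apply: (mulIf a0); rewrite mulrA divfK // mulrC ad mulrC.
Qed.

(** Square roots of the inverse determinants scale both matrices to determinant 1. *)
Lemma diag_conj_exists m a b c d a' b' c' d' : (0 < m)%N ->
  a * d - b * c != 0 -> a' * d' - b' * c' != 0 ->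
  let D := a * d - b * c in let D' := a' * d' - b' * c' in
  b' * c' / D' = b * c / D ->
  a' ^+ m.+2 * b' ^+ m / D' ^+ m.+1 = a ^+ m.+2 * b ^+ m / D ^+ m.+1 ->
  c' ^+ m * d' ^+ m.+2 / D' ^+ m.+1 = c ^+ m * d ^+ m.+2 / D ^+ m.+1 ->
  exists al be k, [/\ al != 0, be != 0, k != 0
    & diag_conj m.+1 al be k a b c d a' b' c' d'].
Proof.
move=> m0 D0 D'0 D D' bc ab cd.
have rt (x : K) : x != 0 -> exists2 s, s != 0 & s ^+ 2 = x^-1.
  move=> x0; exists (sqrtC x^-1); last by rewrite sqrtCK.
  by rewrite sqrtC_eq0 invr_eq0.
have [s s0 sE] := rt _ D0; have [s' s'0 s'E] := rt _ D'0.
have pE (r x y : K) : (r * x) ^+ m.+2 * (r * y) ^+ m = (r ^+ 2) ^+ m.+1 * (x ^+ m.+2 * y ^+ m).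
  have -> : (r ^+ 2) ^+ m.+1 = r ^+ m.+2 * r ^+ m.
    by rewrite -exprM -exprD mul2n -addnn addSnnS addnC.
  by rewrite !exprMn; ring.
have pE' (r x y : K) : (r * x) ^+ m * (r * y) ^+ m.+2 = (r ^+ 2) ^+ m.+1 * (x ^+ m * y ^+ m.+2).
  by rewrite mulrC pE [y ^+ _ * _]mulrC.
have [|||||al [be [k [al0 be0 k0 [h1 h2 h3 h4]]]]] := @diag_conj_exists_det1 m (s * a) (s * b) (s * c) (s * d)
   (s' * a') (s' * b') (s' * c') (s' * d') m0.
- by rewrite mulrACA [s * b * _]mulrACA -mulrBr -expr2 sE mulVf.
- by rewrite mulrACA [s' * b' * _]mulrACA -mulrBr -expr2 s'E mulVf.
- by rewrite mulrACA [s * b * _]mulrACA -!expr2 sE s'E mulrC bc mulrC.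
- by rewrite !pE sE s'E !exprVn mulrC ab mulrC.
- by rewrite !pE' sE s'E !exprVn mulrC cd mulrC.
exists al, be, (k * s / s'); split; rewrite ?mulf_neq0 ?invr_eq0 //.
by split; apply: (mulfI s'0); rewrite mulrA ?h1 ?h2 ?h3 ?h4; field.
Qed.

(** With [n = m + 1], [Y] is a sum [N + M] whose product [N M = X ^ m (1 + X) ^ (m + 2)] depends on
    [X] alone, so [(X, Y)] determines [N] and [M] up to order. The two orders give a diagonal and an
    antidiagonal conjugacy. *)
Lemma normal_form_conjugate n f g a b c d a' b' c' d' : (1 < n)%N ->
  is_normal_form n f a b c d -> is_normal_form n g a' b' c' d' ->
  invX a' b' c' d' = invX a b c d -> invY n a' b' c' d' = invY n a b c d ->
  conjugate f g.
Proof.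
case: n => // m; rewrite ltnS => m0 nf ng EX EY; have n0 := ltn0Sn m.
have df := rdegree_normal_form n0 nf; have dg := rdegree_normal_form n0 ng.
apply/(conjugate_lift n0 df dg).
have [D fn fd] := nf; have [D' gn gd] := ng.
have hf u v : homog m.+1 (rnum f) u v = a * u ^+ m.+1 + b * v ^+ m.+1 /\
    homog m.+1 (rden f) u v = c * u ^+ m.+1 + d * v ^+ m.+1.
  by rewrite fn fd !hom_binomial.
have hg u v : homog m.+1 (rnum g) u v = a' * u ^+ m.+1 + b' * v ^+ m.+1 /\
    homog m.+1 (rden g) u v = c' * u ^+ m.+1 + d' * v ^+ m.+1.
  by rewrite gn gd !hom_binomial.
pose N (a b c d : K) := a ^+ m.+2 * b ^+ m / (a * d - b * c) ^+ m.+1.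
pose M (a b c d : K) := c ^+ m * d ^+ m.+2 / (a * d - b * c) ^+ m.+1.
have sumE : N a' b' c' d' + M a' b' c' d' = N a b c d + M a b c d.
  by rewrite /N /M -!mulrDl.
have prodE : N a' b' c' d' * M a' b' c' d' = N a b c d * M a b c d.
  have P (p q r s : K) : p * s - q * r != 0 ->
      N p q r s * M p q r s = invX p q r s ^+ m * (1 + invX p q r s) ^+ m.+2.
    move=> D1; have -> : 1 + invX p q r s = p * s / (p * s - q * r) by rewrite /invX; field.
    rewrite /N /M /invX mulf_div -exprD !exprMn !exprVn.
    have -> : ((m.+1 + m.+1) = m + m.+2)%N by rewrite addSnnS.
    by rewrite exprD; field; rewrite !expf_neq0.
  by rewrite !P // EX.
have : (N a' b' c' d' - N a b c d) * (N a' b' c' d' - M a b c d) = 0.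
  transitivity (N a' b' c' d' ^+ 2 - N a' b' c' d' * (N a b c d + M a b c d) + N a b c d * M a b c d).
    by ring.
  by rewrite -sumE -prodE; ring.
move=> /eqP; rewrite mulf_eq0 !subr_eq0 => /orP[] /eqP NE.
  have ME : M a' b' c' d' = M a b c d by move: sumE; rewrite NE => /addrI.
  have [al [be [k [al0 be0 k0 [h1 h2 h3 h4]]]]] := diag_conj_exists m0 D D' EX NE ME.
  exists al, 0, 0, be, k; split=> //; first by rewrite mulr0 subr0 mulf_neq0.
  move=> u v; rewrite !(hf _ _).1 !(hf _ _).2 !(hg _ _).1 !(hg _ _).2.
  rewrite !mul0r !addr0 !add0r !exprMn !mulrDr !mulrA h1 h2 h3 h4; split; ring.
have ME : M a' b' c' d' = N a b c d by move: sumE; rewrite NE addrC => /addIr.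
have [||||al [be [k [al0 be0 k0 [h1 h2 h3 h4]]]]] := @diag_conj_exists m a b c d d' c' b' a' m0 D.
- by rewrite mulrC [c' * _]mulrC.
- by rewrite [c' * _]mulrC [d' * _]mulrC.
- by rewrite -/(N a b c d) -ME /M [d' * a']mulrC [c' * b']mulrC [d' ^+ _ * _]mulrC.
- by rewrite -/(M a b c d) -NE /N [d' * a']mulrC [c' * b']mulrC [b' ^+ _ * _]mulrC.
exists 0, be, al, 0, k; split=> //.
  by rewrite mulr0 sub0r oppr_eq0 mulf_neq0.
move=> u v; rewrite !(hf _ _).1 !(hf _ _).2 !(hg _ _).1 !(hg _ _).2.
rewrite !mul0r !addr0 !add0r !exprMn !mulrDr !mulrA h1 h2 h3 h4; split; ring.
Qed.

(** The normal form [g] keeps [xget] from its default value, and [normal_form_inv] makes the choice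
    of normal form immaterial. *)
Lemma coordXY_normal_form n f g a b c d : (1 < n)%N ->
  conjugate f g -> is_normal_form n g a b c d ->
  coordXY n (conj_class f) = (invX a b c d, invY n a b c d).
Proof.
move=> n1 fg ng; rewrite /coordXY; set S := [set _ | _].
have : S (xget (0, 0) S).
  by apply: (@xgetPex _ (0, 0) S); exists (invX a b c d, invY n a b c d); exists g, a, b, c, d.
move=> [h [a' [b' [c' [d' [fh nh ->]]]]]].
have [-> ->] // := normal_form_inv n1 ng nh (conjugate_trans (conjugate_sym fg) fh).
Qed.

Lemma coordXY_inj n f g : (1 < n)%N ->
  rdegree f = n -> bicritical f -> rdegree g = n -> bicritical g ->
  coordXY n (conj_class f) = coordXY n (conj_class g) -> conj_class f = conj_class g.
Proof.
move=> n1 df bf dg bg.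
have [f' [a [b [c [d [ff' nf']]]]]] := bicritical_normal_form n1 df bf.
have [g' [a' [b' [c' [d' [gg' ng']]]]]] := bicritical_normal_form n1 dg bg.
rewrite (coordXY_normal_form n1 ff' nf') (coordXY_normal_form n1 gg' ng') => -[EX EY].
apply: conj_class_eq; apply: (conjugate_trans ff').
exact: conjugate_trans (normal_form_conjugate n1 nf' ng' (esym EX) (esym EY)) (conjugate_sym gg').
Qed.

End ModuliCoordinates.

(** * The curves Per_1 *)

Section FixedPointCurve.
Variable K : numClosedFieldType.
Implicit Types (f g : ratmap K) (a b c d l x p q lam : K) (n m i j : nat).

(* [Per_1 (lam)] in degree [m + 1] is the graph of [curve (lam / (m + 1)) m]; the
   recursion is the one satisfied by the power sums in [horner_curve]. *)
Fixpoint curve l j : {poly K} :=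
  match j with
  | 0 => (-2) *: 'X + (l + l^-1)%:P
  | i.+1 =>
    match i with
    | 0 => (-2) *: ('X * 'X) + (4 * l + 1 + l^-1) *: 'X + (l * (1 - l))%:P
    | h.+1 => 2 *: ('X * curve l i) + (1 - l) *: curve l i
              - 'X * ('X * curve l h) - 'X * curve l h
    end
  end.

Arguments curve : simpl never.

Lemma curveSS l j : curve l j.+2 = 2 *: ('X * curve l j.+1) + (1 - l) *: curve l j.+1
   - 'X * ('X * curve l j) - 'X * curve l j.
Proof. by []. Qed.

Lemma nat_pair_ind (P : nat -> Prop) :
  P 0%N -> P 1%N -> (forall j, P j -> P j.+1 -> P j.+2) -> forall j, P j.
Proof.
move=> P0 P1 PS j; suff [] : P j /\ P j.+1 by [].
by elim: j => [|j [IH1 IH2]]; split=> //; apply: PS.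
Qed.

Lemma coef_curve_gt l j i : (j.+1 < i)%N -> (curve l j)`_i = 0.
Proof.
elim/nat_pair_ind: j i => [i|i|j IH1 IH2 i lti].
- case: i => [|[|i]] // _.
  by rewrite coefD coefZ coefX coefC /= mulr0 addr0.
- case: i => [|[|[|i]]] // _.
  by rewrite !coefD !coefZ coefXM !coefX coefC /= !mulr0 !addr0.
rewrite curveSS !coefB coefD !coefZ !coefXM.
case: i lti => [|[|i]] //; rewrite !ltnS => lti /=.
by rewrite (IH2 i.+1 lti) (IH2 i.+2 (leqW lti)) (IH1 i lti) (IH1 i.+1 (leqW lti)) !mulr0 addr0 !subr0.
Qed.

Lemma coef_curve_top l j : (curve l j)`_j.+1 = -2.
Proof.
elim/nat_pair_ind: j => [||j IH1 IH2].
- by rewrite coefD coefZ coefX coefC /= mulr1 addr0.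
- by rewrite !coefD !coefZ coefXM !coefX coefC /= mulr1 mulr0 !addr0.
rewrite curveSS !coefB coefD !coefZ !coefXM /= IH1 IH2.
by rewrite !coef_curve_gt //; ring.
Qed.

(** Along this diagonal the recursion has constant second difference [2 l], whence a quadratic in
    [j]. For [l = lam / n] and [j = n - 1] it equals [n (lam + lam^-1 + 1) - 1]. *)
Lemma coef_curve_next l j : l != 0 ->
  (curve l j)`_j = l * j.+1%:R ^+ 2 + j%:R + l^-1.
Proof.
move=> l0; elim/nat_pair_ind: j => [||j IH1 IH2].
- by rewrite coefD coefZ coefX coefC /=; ring.
- by rewrite !coefD !coefZ coefXM !coefX coefC /=; ring.
rewrite curveSS !coefB coefD !coefZ !coefXM /= IH1 IH2 !coef_curve_top.
by rewrite -[j.+3]addn3 -[j.+2]addn2 -[j.+1]addn1 !natrD; field.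
Qed.

(** Only the factor [1 - l] of the recursion survives at [X = 0]. The formula starts at index 1,
    since [curve l 0] has constant term [l + l^-1]. *)
Lemma coef_curve0 l j : (curve l j.+1)`_0 = l * (1 - l) ^+ j.+1.
Proof.
elim: j => [|j IH].
  by rewrite !coefD !coefZ coefXM !coefX coefC /= !mulr0 !add0r.
rewrite curveSS !coefB coefD !coefZ !coefXM IH [(1 - l) ^+ j.+2]exprS /=; ring.
Qed.

Lemma size_curve l j : size (curve l j) = j.+2.
Proof.
apply/eqP; rewrite eqn_leq; apply/andP; split.
  by apply/leq_sizeP => i; apply: coef_curve_gt.
rewrite ltnNge; apply/negP => sz.
have := coef_curve_top l j; rewrite nth_default // => /esym/eqP.
by rewrite oppr_eq0 pnatr_eq0.
Qed.

(** Newton's recursion for power sums in [p (1 - p) / l] and [q (1 - q) / l], whose sum is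
    [2 x + 1 - l] and whose product is [x (x + 1)]. *)
Lemma horner_curve l p q x j : l != 0 -> p + q = 1 + l -> p * q = l * (x + 1) ->
  (curve l j).[x] =
    (p ^+ 2 * (p * (1 - p)) ^+ j + q ^+ 2 * (q * (1 - q)) ^+ j) / l ^+ j.+1.
Proof.
move=> l0 pq_sum pq_prod.
have lE : l = p + q - 1 by rewrite pq_sum addrC addKr.
have xE : x = p * q / l - 1 by rewrite pq_prod mulrC mulKf // addrK.
elim/nat_pair_ind: j => [||j IH1 IH2].
- rewrite !(hornerD, hornerZ, hornerX, hornerC) xE lE; field.
  by rewrite -lE.
- rewrite !(hornerD, hornerM, hornerZ, hornerX, hornerC) xE lE; field.
  by rewrite -lE.
rewrite curveSS !(hornerD, hornerN, hornerM, hornerZ, hornerX) IH1 IH2.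
transitivity ((2 * x + 1 - l) *
    ((p ^+ 2 * (p * (1 - p)) ^+ j.+1 + q ^+ 2 * (q * (1 - q)) ^+ j.+1) / l ^+ j.+2) -
  x * (x + 1) * ((p ^+ 2 * (p * (1 - p)) ^+ j + q ^+ 2 * (q * (1 - q)) ^+ j) / l ^+ j.+1)).
  by ring.
have -> : 2 * x + 1 - l = (p * (1 - p) + q * (1 - q)) / l.
  by rewrite xE lE; field; rewrite -lE.
have -> : x * (x + 1) = (p * (1 - p)) * (q * (1 - q)) / l ^+ 2.
  by rewrite xE lE; field; rewrite -lE.
rewrite ![_ ^+ j.+3]exprS ![_ ^+ j.+2]exprS ![_ ^+ j.+1]exprS.
have L0 : l ^+ j != 0 by rewrite expf_neq0.
move: (p * (1 - p)) (q * (1 - q)) => P Q.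
move: (P ^+ j) (Q ^+ j) (l ^+ j) L0 => P' Q' L L0.
by field; rewrite l0 L0.
Qed.

Lemma normal_form_curve m f a b c d lam : (0 < m)%N -> lam != 0 ->
  is_normal_form m.+1 f a b c d -> has_fixed_point_of_multiplier f lam ->
  invY m.+1 a b c d = (curve (lam / m.+1%:R) m).[invX a b c d].
Proof.
move=> m0 lam0 nf; have df := rdegree_normal_form (ltn0Sn m) nf.
have n0 : m.+1%:R != 0 :> K by rewrite pnatr_eq0.
rewrite multiplier_form df // => -[u [v [e [nz e0]]]].
rewrite (fjac_normal_form _ _ (ltn0Sn m) nf) /fnum /fden df.
case: nf => D -> ->; rewrite !hom_binomial //= => Eu Ev Ej.
pose l := lam / m.+1%:R; have l0 : l != 0 by rewrite mulf_neq0 ?invr_eq0.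
have Dl : (a * d - b * c) * (u * v) ^+ m = e ^+ 2 * l.
  apply: (mulfI (expf_neq0 2 n0)); rewrite mulrA Ej /l.
  by move: (m.+1%:R) n0 => N n0; field.
(* As [lam != 0], the fixed point is none of the critical points 0 and infinity. *)
have uv0 : u * v != 0.
  apply: contra_eq_neq Dl => ->; rewrite expr0n (gtn_eqF m0) mulr0 eq_sym.
  by rewrite mulf_neq0 ?expf_neq0.
have [u0 v0] : u != 0 /\ v != 0 by apply/andP; rewrite -negb_or -mulf_eq0.
have [A EA] : exists A, A = u ^+ m by exists (u ^+ m).
have [B EB] : exists B, B = v ^+ m by exists (v ^+ m).
have A0 : A != 0 by rewrite EA expf_neq0.
have B0 : B != 0 by rewrite EB expf_neq0.
move: Eu Ev Dl; rewrite exprMn ![_ ^+ m.+1]exprS -EA -EB => Eu Ev Dl.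
(* The fixed point equations turn into [b v ^ n / (e u) = 1 - p] and [c u ^ n / (e v) = 1 - q], so
   that [p], [q], [e], [u], [v] express all four coefficients. *)
have [p Ep] : exists p, p = a * A / e by exists (a * A / e).
have [q Eq] : exists q, q = d * B / e by exists (d * B / e).
have aE : a = p * e / A by rewrite Ep; field; rewrite e0 A0.
have dE : d = q * e / B by rewrite Eq; field; rewrite e0 B0.
have bE : b = (1 - p) * e * u / (v * B).
  have -> : (1 - p) * e * u = b * (v * B).
    by rewrite Ep mulrBl mul1r divfK // mulrBl -Eu; ring.
  by rewrite mulfK // mulf_neq0.
have cE : c = (1 - q) * e * v / (u * A).
  have -> : (1 - q) * e * v = c * (u * A).
    by rewrite Eq mulrBl mul1r divfK // mulrBl -Ev; ring.
  by rewrite mulfK // mulf_neq0.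
have [T ET] : exists T, T = e ^+ 2 / (A * B) by exists (e ^+ 2 / (A * B)).
have T0 : T != 0 by rewrite ET mulf_neq0 ?expf_neq0 ?invr_eq0 ?mulf_neq0.
(* The determinant is computed once from the Jacobian and once from the coefficients; comparison
   gives [l = p + q - 1]. *)
have DE : a * d - b * c = T * l.
  by rewrite ET mulrAC -Dl mulfK // mulf_neq0.
have DE' : a * d - b * c = T * (p + q - 1).
  by rewrite aE bE cE dE ET; field; rewrite u0 v0 A0 B0.
have lE : l = p + q - 1 by apply: (mulfI T0); rewrite -DE -DE'.
have XE : invX a b c d = (1 - p) * (1 - q) / l.
  rewrite /invX DE; have -> : b * c = T * ((1 - p) * (1 - q)).
    by rewrite bE cE ET; field; rewrite u0 v0 A0 B0.
  by rewrite -mulf_div divff // mul1r.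
rewrite -/l (@horner_curve l p q) //; first last.
- by rewrite XE mulrDr mulr1 mulrCA divff // mulr1 lE; ring.
- by rewrite lE; ring.
have split2 (r s : K) : r ^+ m.+2 * s ^+ m = (r * s) ^+ m * r ^+ 2.
  by rewrite exprMn -addn2 exprD; ring.
have abE : a ^+ m.+2 * b ^+ m = T ^+ m.+1 * (p ^+ 2 * (p * (1 - p)) ^+ m).
  rewrite split2 [a * b](_ : _ = T * (p * (1 - p)) * (u / v)); last first.
    by rewrite aE bE ET; field; rewrite v0 A0 B0.
  rewrite ![(T * _ * _) ^+ m]exprMn [(T * _) ^+ m]exprMn [(u / v) ^+ m]exprMn exprVn -EA -EB aE [T ^+ m.+1]exprS {2}ET.
  by field; rewrite A0 B0.
have cdE : c ^+ m * d ^+ m.+2 = T ^+ m.+1 * (q ^+ 2 * (q * (1 - q)) ^+ m).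
  rewrite mulrC split2 [d * c](_ : _ = T * (q * (1 - q)) * (v / u)); last first.
    by rewrite dE cE ET; field; rewrite u0 A0 B0.
  rewrite ![(T * _ * _) ^+ m]exprMn [(T * _) ^+ m]exprMn [(v / u) ^+ m]exprMn exprVn -EA -EB dE [T ^+ m.+1]exprS {2}ET.
  by field; rewrite A0 B0.
rewrite /invY /= abE cdE DE [(T * l) ^+ _]exprMn -mulrDr.
by rewrite -mulf_div divff ?expf_neq0 // mul1r.
Qed.

(** The fixed point is placed at 1 with eigenvalue 1: [p] and [q] are the roots of
    [t ^ 2 - (1 + l) t + l (x + 1)], and the map is [(p z ^ n + 1 - p) / ((1 - q) z ^ n + q)]. *)
Lemma curve_normal_form m lam x : (0 < m)%N -> lam != 0 ->
  exists f a b c d, [/\ is_normal_form m.+1 f a b c d,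
    has_fixed_point_of_multiplier f lam & invX a b c d = x].
Proof.
move=> m0 lam0; have n0 : m.+1%:R != 0 :> K by rewrite pnatr_eq0.
pose l := lam / m.+1%:R; have l0 : l != 0 by rewrite mulf_neq0 ?invr_eq0.
pose s := sqrtC ((1 + l) ^+ 2 - 4 * l * (x + 1)).
have s2 : s ^+ 2 = (1 + l) ^+ 2 - 4 * l * (x + 1) by rewrite sqrtCK.
pose p := (1 + l + s) / 2; pose q := (1 + l - s) / 2.
have two0 : (2 : K) != 0 by rewrite pnatr_eq0.
have pqD : p + q = 1 + l by rewrite /p /q; field.
have pqM : p * q = l * (x + 1).
  transitivity (((1 + l) ^+ 2 - s ^+ 2) / 4); first by rewrite /p /q; field.
  by rewrite s2; field.
have D : p * q - (1 - p) * (1 - q) = l.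
  by transitivity (p + q - 1); [ring | rewrite pqD; ring].
have D0 : p * q - (1 - p) * (1 - q) != 0 by rewrite D.
have [f nf] := normal_form_exists (ltn0Sn m) D0.
exists f, p, (1 - p), (1 - q), q; split=> //; last first.
  rewrite /invX D; apply: (mulIf l0); rewrite divfK //.
  transitivity (1 - (p + q) + p * q); first by ring.
  by rewrite pqD pqM; ring.
have df := rdegree_normal_form (ltn0Sn m) nf.
apply/multiplier_form; rewrite df //; exists 1, 1, 1.
rewrite (fjac_normal_form _ _ (ltn0Sn m) nf) D /fnum /fden df.
case: nf => _ -> ->; rewrite !hom_binomial // !expr1n !mulr1 /nonzero !oner_eq0.
split=> //; rewrite ?expr1n ?mulr1; [ring | ring |].
by rewrite /l; move: (m.+1%:R) n0 => N n0; field.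
Qed.

Lemma coordXY_Per1 m lam : (0 < m)%N -> lam != 0 ->
  coordXY m.+1 @` Per1 m.+1 lam = [set xy | xy.2 = (curve (lam / m.+1%:R) m).[xy.1]].
Proof.
move=> m0 lam0; have n1 : (1 < m.+1)%N by [].
apply/seteqP; split=> [_ /= [_ [f [df bf mf] <-] <-]|[x y] /= ->].
  have [g [a [b [c [d [fg ng]]]]]] := bicritical_normal_form n1 df bf.
  rewrite (coordXY_normal_form n1 fg ng) /=; apply: (normal_form_curve m0 lam0 ng).
  apply: (multiplier_conjugate _ _ fg mf); rewrite ?df //.
  by rewrite (rdegree_normal_form _ ng).
have [f [a [b [c [d [nf mf <-]]]]]] := curve_normal_form x m0 lam0.
exists (conj_class f).
  exists f => //; split=> //; first exact: (rdegree_normal_form _ nf).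
  exact: (normal_form_bicritical n1 nf).
rewrite (coordXY_normal_form n1 (conjugate_refl f) nf).
by rewrite (normal_form_curve m0 lam0 nf mf).
Qed.

End FixedPointCurve.

(** * Intersection multiplicity of two graphs *)

Lemma cross_multiply (L : fieldType) (f g s1 s2 t1 t2 a b : L) :
  g != 0 -> s2 != 0 -> t2 != 0 -> f / g = s1 / s2 * a + t1 / t2 * b ->
  f * s2 * t2 = g * (s1 * t2 * a + t1 * s2 * b).
Proof.
move=> g0 s0 t0 E; rewrite -[f in LHS](divfK g0) E; field.
by rewrite s0 t0.
Qed.

Lemma split_fraction (L : fieldType) (f g q s t a b : L) :
  q != 0 -> g != 0 -> q * f = s * a + t * b ->
  f / g = s / (q * g) * a + t / (q * g) * b.
Proof.
move=> q0 g0 E; apply: (mulfI q0); rewrite mulrA E; field.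
by rewrite q0 g0.
Qed.

Lemma tofrac_combination (R : idomainType) (f q s t a b : R) :
  q * f = s * a + t * b ->
  tofrac q * tofrac f = tofrac s * tofrac a + tofrac t * tofrac b.
Proof. by move=> E; rewrite -!tofracM -tofracD E. Qed.

Lemma tofrac_div_mul (R : idomainType) (k q g : R) :
  tofrac k / (tofrac q * tofrac g) = tofrac k / tofrac (q * g).
Proof. by rewrite tofracM. Qed.

Lemma tofrac_sub (R : idomainType) (f g c : R) : tofrac g != 0 ->
  tofrac f / tofrac g - tofrac c = tofrac (f - c * g) / tofrac g.
Proof. by move=> g0; rewrite tofracB tofracM mulrBl mulfK. Qed.

Section GraphIntersection.
Variable K : numClosedFieldType.
Implicit Types (F G H : {poly {poly K}}) (P Q w : {poly K}) (x : K).

Definition graph P : set (K * K) := [set xy | xy.2 = P.[xy.1]].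

Lemma eval2_graph F P x : eval2 F (x, P.[x]) = F.[P].[x].
Proof.
rewrite /eval2 /=; elim/poly_ind: F => [|F c IH]; first by rewrite !horner0.
by rewrite !hornerMXaddC !(hornerD, hornerM) IH hornerC.
Qed.

(** On the graph [F] becomes a polynomial in [x] alone, and one that vanishes everywhere is 0. *)
Lemma vanishing_ideal_graph F P : vanishing_ideal (graph P) F <-> F.[P] = 0.
Proof.
split=> [h|F0 [x y]]; last by rewrite /graph /= => ->; rewrite eval2_graph F0 horner0.
by apply: poly_zero_fun => x; rewrite -eval2_graph; apply: h.
Qed.

Lemma divide_graph F P : exists H, F = H * ('X - P%:P) + (F.[P])%:P.
Proof.
have /factor_theorem[H E] : root (F - (F.[P])%:P) P.
  by rewrite /root hornerD hornerN hornerC subrr.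
by exists H; rewrite -E subrK.
Qed.

Variables (P P' : {poly K}) (x0 : K).
Hypothesis PP' : P - P' != 0.
Let mu := mup x0 (P - P').
Let p0 : K * K := (x0, P.[x0]).

(* The local ring modulo [Y - P(X)] is the local ring of the line at [x0], and
   there [Y - P'(X)] becomes [P - P'], a unit times [(X - x0) ^ mu]. *)
Lemma local_ideal_graph F G : eval2 G p0 != 0 ->
  local_ideal (graph P) (graph P') p0 (tofrac F / tofrac G) <->
  ('X - x0%:P) ^+ mu %| F.[P].
Proof.
rewrite eval2_graph => G0.
have nz H : H.[P].[x0] != 0 -> tofrac H != 0.
  by rewrite tofrac_eq0; apply: contraNneq => ->; rewrite !horner0.
have dvdQ : ('X - x0%:P) ^+ mu %| P - P' by rewrite -mup_geq.
split.
- move=> [_ [_ [F1 [F2 [[S1 [S2 [S20 ->]]] [T1 [T2 [T20 ->]]] hF1 hF2]]]]].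
  rewrite eval2_graph in S20; rewrite eval2_graph in T20.
  move=> E; move/vanishing_ideal_graph: hF1 => hF1.
  move/vanishing_ideal_graph: hF2 => hF2.
  (* After substituting [Y = P(X)] the term of [F1] disappears and that of [F2] is a multiple of
     [P - P']; [S2] and [T2] do not vanish at the point, so they are coprime to the power of
     [X - x0]. *)
  have : F * S2 * T2 = G * (S1 * T2 * F1 + T1 * S2 * F2).
    apply/eqP; rewrite -tofrac_eq !(tofracM, tofracD); apply/eqP.
    by apply: cross_multiply E; apply: nz.
  move/(congr1 (fun H => H.[P])); rewrite !(hornerM, hornerD) hF1 mulr0 add0r => EP.
  have [H HE] := divide_graph F2 P'; rewrite hF2 addr0 in HE.
  have F2P : F2.[P] = H.[P] * (P - P') by rewrite {1}HE !(hornerM, hornerD, hornerN, hornerX, hornerC).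
  have cop w : w.[x0] != 0 -> coprimep (('X - x0%:P) ^+ mu) w.
    by move=> w0; apply: coprimep_expl; rewrite coprimep_sym coprimep_XsubC.
  rewrite -(Gauss_dvdpl _ (cop _ S20)) -(Gauss_dvdpl _ (cop _ T20)) EP F2P.
  by rewrite !dvdp_mull.
- move=> /dvdpP[k kE]; have [H HE] := divide_graph F P.
  (* The cofactor [Q] is a unit at [x0] because [mu] is the exact multiplicity. *)
  have [Q Q0 QE] : exists2 Q, Q.[x0] != 0 & P - P' = Q * ('X - x0%:P) ^+ mu.
    move/dvdpP: dvdQ => [Q QE]; exists Q => //; apply/negP => /eqP Qx.
    have /factor_theorem[w wE] : root Q x0 by apply/eqP.
    have : ('X - x0%:P) ^+ mu.+1 %| P - P' by rewrite QE wE -mulrA -exprS dvdp_mull.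
    by rewrite -mup_geq // ltnn.
  (* Since [P - P' = (Y - P') - (Y - P)], multiplying [F = H (Y - P) + k (X - x0) ^ mu] by the unit
     [Q] expresses it in the two equations of the graphs. *)
  have E : Q%:P * F = (Q%:P * H - k%:P) * ('X - P%:P) + k%:P * ('X - P'%:P).
    rewrite {1}HE kE.
    transitivity (Q%:P * H * ('X - P%:P) + (k * (Q * ('X - x0%:P) ^+ mu))%:P).
      by rewrite mulrDr mulrA -polyCM; congr (_ + _%:P); exact: mulrCA.
    by rewrite -QE polyCM polyCB; ring.
  have QG0 : (Q%:P * G).[P].[x0] != 0 by rewrite !hornerM hornerC mulf_neq0.
  exists (tofrac (Q%:P * H - k%:P) / (tofrac Q%:P * tofrac G)).
  exists (tofrac k%:P / (tofrac Q%:P * tofrac G)).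
  exists ('X - P%:P), ('X - P'%:P); split.
  + exists (Q%:P * H - k%:P), (Q%:P * G); rewrite eval2_graph; split=> //; exact: tofrac_div_mul.
  + exists k%:P, (Q%:P * G); rewrite eval2_graph; split=> //; exact: tofrac_div_mul.
  + by apply/vanishing_ideal_graph; rewrite hornerD hornerN hornerX hornerC subrr.
  + by apply/vanishing_ideal_graph; rewrite hornerD hornerN hornerX hornerC subrr.
  have nzQ : tofrac Q%:P != 0 by apply: nz; rewrite hornerC.
  have nzG : tofrac G != 0 by apply: nz.
  exact: split_fraction nzQ nzG (tofrac_combination E).
Qed.

(** Coordinates [c] in the basis [(X - x0) ^ i], [i < d], of the quotient of [K[X]] by
    [(X - x0) ^ d]. *)
Definition shifted_poly d (c : 'rV[K]_d) : {poly K} :=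
  \sum_(i < d) c 0 i *: ('X - x0%:P) ^+ i.

Lemma shifted_polyE d (c : 'rV[K]_d) :
  shifted_poly c = (\sum_(i < d) c 0 i *: 'X^i) \Po ('X - x0%:P).
Proof.
rewrite /shifted_poly (raddf_sum (comp_poly ('X - x0%:P))); apply: eq_bigr => i _.
by rewrite /= comp_polyZ comp_Xn_poly.
Qed.

Lemma size_monomial_sum d (c : 'rV[K]_d) : (size (\sum_(i < d) c 0 i *: 'X^i)%R <= d)%N.
Proof.
apply: (leq_trans (size_sum _ _ _)); apply/bigmax_leqP => i _.
by rewrite (leq_trans (size_scale_leq _ _)) // size_polyXn.
Qed.

Lemma coef_monomial_sum d (c : 'rV[K]_d) (i : 'I_d) : (\sum_(j < d) c 0 j *: 'X^j)`_i = c 0 i.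
Proof.
rewrite coef_sum (bigD1 i) //= coefZ coefXn eqxx mulr1 big1 ?addr0 // => j ji.
by rewrite coefZ coefXn eq_sym (inj_eq val_inj) (negbTE ji) mulr0.
Qed.

(** Linear independence: the degree is too small for a nonzero multiple of [(X - x0) ^ d]. *)
Lemma shifted_poly_dvd d (c : 'rV[K]_d) : ('X - x0%:P) ^+ d %| shifted_poly c -> c = 0.
Proof.
rewrite shifted_polyE; set q := \sum_(i < d) _ => dv.
have q0 : q = 0.
  apply/eqP; rewrite -(comp_poly2_eq0 q (size_XsubC x0)); apply: contraLR dv => q0.
  apply/negP => /(dvdp_leq q0); rewrite size_exp_XsubC size_comp_poly2 ?size_XsubC //.
  by rewrite ltnNge size_monomial_sum.
by apply/rowP => i; rewrite mxE -coef_monomial_sum -/q q0 coef0.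
Qed.

(** Spanning: the remainder of [w] is expanded in powers of [X - x0] by translating the variable. *)
Lemma shifted_poly_mod d w : exists c : 'rV[K]_d, ('X - x0%:P) ^+ d %| w - shifted_poly c.
Proof.
pose r := w %% ('X - x0%:P) ^+ d; pose q := r \Po ('X + x0%:P).
have szr : (size r <= d)%N.
  have := ltn_modp w (('X - x0%:P) ^+ d).
  by rewrite expf_neq0 ?polyXsubC_eq0 // size_exp_XsubC ltnS.
have szq : (size q <= d)%N by rewrite size_comp_poly2 ?size_XaddC.
exists (\row_i q`_i); rewrite shifted_polyE.
have -> : \sum_(i < d) (\row_i q`_i) 0 i *: 'X^i = q.
  apply/polyP => i; have [lti|lei] := ltnP i d.
    by rewrite (coef_monomial_sum _ (Ordinal lti)) mxE.
  by rewrite !nth_default // (leq_trans _ lei) // size_monomial_sum.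
by rewrite comp_polyXaddC_K {1}(divp_eq w (('X - x0%:P) ^+ d)) addrK dvdp_mull.
Qed.

(** By [local_ideal_graph] the quotient of the local ring is that of [K[X]] by [(X - x0) ^ mu], with
    the powers of [X - x0] as basis. *)
Lemma intersection_multiplicity_graph :
  intersection_multiplicity (graph P) (graph P') p0 mu.
Proof.
exists (fun i => tofrac ((('X - x0%:P) ^+ i)%:P)); split.
  move=> i; exists ((('X - x0%:P) ^+ i)%:P), 1; rewrite tofrac1 divr1 eval2_graph.
  by rewrite hornerC hornerC oner_eq0.
move=> _ [F [G [G0 ->]]].
have E (c : 'rV[K]_mu) :
    tofrac F / tofrac G - \sum_(i < mu) tofrac ((c 0 i)%:P%:P) * tofrac ((('X - x0%:P) ^+ i)%:P) =
    tofrac (F - (shifted_poly c)%:P * G) / tofrac G.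
  have nzG : tofrac G != 0.
    by rewrite tofrac_eq0; apply: contraNneq G0 => ->; rewrite eval2_graph !horner0.
  rewrite -tofrac_sub //; congr (_ - _).
  rewrite /shifted_poly (raddf_sum polyC) (raddf_sum (@tofrac _)); apply: eq_bigr => i _.
  by rewrite -(tofracM (c 0 i)%:P%:P) -polyCM mul_polyC.
have dvE (c : 'rV[K]_mu) : local_ideal (graph P) (graph P') p0 (tofrac F / tofrac G -
     \sum_(i < mu) tofrac ((c 0 i)%:P%:P) * tofrac ((('X - x0%:P) ^+ i)%:P)) <->
    ('X - x0%:P) ^+ mu %| F.[P] - shifted_poly c * G.[P].
  by rewrite E local_ideal_graph // hornerD hornerN hornerM hornerC.
rewrite eval2_graph in G0.
have cop : coprimep (('X - x0%:P) ^+ mu) G.[P].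
  by apply: coprimep_expl; rewrite coprimep_sym coprimep_XsubC.
(* Here [t] inverts [G(X, P(X))] modulo [(X - x0) ^ mu], so [t F(X, P(X))] represents the class of
   [F / G]. *)
have /Bezout_eq1_coprimepP[[s t] /= st] := cop.
have [c cE] := shifted_poly_mod mu (t * F.[P]).
exists c; split.
  apply/dvE; have -> : F.[P] - shifted_poly c * G.[P] =
      (t * F.[P] - shifted_poly c) * G.[P] + s * ('X - x0%:P) ^+ mu * F.[P].
    by rewrite -{1}[F.[P]]mul1r -st; move: (_ ^+ mu) => Z; ring.
  by apply: dvdp_add; [apply: dvdp_mulr | apply/dvdp_mulr/dvdp_mull].
move=> c' /dvE; move: (c) cE => c1 c1E hc'.
apply/eqP; rewrite -subr_eq0; apply/eqP/shifted_poly_dvd.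
have -> : shifted_poly (c1 - c') = shifted_poly c1 - shifted_poly c'.
  rewrite /shifted_poly -sumrB; apply: eq_bigr => i _.
  by rewrite !mxE scalerBl.
rewrite -(Gauss_dvdpl _ cop).
have -> : (shifted_poly c1 - shifted_poly c') * G.[P] =
    (F.[P] - shifted_poly c' * G.[P]) -
    ((t * F.[P] - shifted_poly c1) * G.[P] + s * ('X - x0%:P) ^+ mu * F.[P]).
  by rewrite -{1}[F.[P]]mul1r -st; move: (_ ^+ mu) => Z; ring.
by apply: dvdp_sub => //; apply: dvdp_add; [apply: dvdp_mulr | apply/dvdp_mulr/dvdp_mull].
Qed.

End GraphIntersection.

(** Over an algebraically closed field [Q] splits, and the multiplicity of a root is its number of
    occurrences in the list of linear factors. *)
Lemma sum_mup_roots (K : closedFieldType) (Q : {poly K}) : Q != 0 ->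
  exists rs : seq K, [/\ uniq rs, (forall x, (x \in rs) = root Q x)
    & (\sum_(x <- rs) mup x Q)%N = (size Q).-1].
Proof.
move=> Q0; have [rs QE] := closed_field_poly_normal Q.
have lc0 : lead_coef Q != 0 by rewrite lead_coef_eq0.
exists (undup rs); split; first exact: undup_uniq.
  by move=> x; rewrite mem_undup QE rootZ // root_prod_XsubC.
have mupE x : mup x Q = count_mem x rs.
  by rewrite QE -mul_polyC mupMr ?mu_prod_XsubC // rootC.
rewrite (eq_bigr _ (fun x _ => mupE x)).
have -> : (size Q).-1 = size rs by rewrite QE size_scale // size_prod_XsubC.
rewrite -sum1_size -(big_undup_iterop_count addn rs xpredT (fun=> 1%N)).
by apply: eq_bigr => x _; rewrite Monoid.iteropE iter_addn_0 mul1n.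
Qed.

(** * Graph form and intersections of the curves Per_1 *)

Section IntersectionOfPer1.
Variable K : numClosedFieldType.
Implicit Types (lam x : K) (m : nat).

Lemma Per1_graph m lam : (0 < m)%N -> lam != 0 ->
  exists P : {poly K},
    [/\ size P = m.+2, P`_m.+1 = - 2,
        P`_m = m.+1%:R * (lam + lam^-1 + 1) - 1,
        P`_0 = lam * (m.+1%:R - lam) ^+ m / m.+1%:R ^+ m.+1
      & coordXY m.+1 @` Per1 m.+1 lam = [set xy | xy.2 = P.[xy.1]]].
Proof.
move=> m0 lam0; have n0 : m.+1%:R != 0 :> K by rewrite pnatr_eq0.
have l0 : lam / m.+1%:R != 0 by rewrite mulf_neq0 ?invr_eq0.
exists (curve (lam / m.+1%:R) m); split.
- exact: size_curve.
- exact: coef_curve_top.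
- rewrite coef_curve_next //.
  have -> : m%:R = m.+1%:R - 1 :> K by rewrite -natr1 addrK.
  by move: (m.+1%:R) n0 {l0} => N n0; field; rewrite lam0 n0.
- case: m m0 n0 {l0} => // m _ n0; rewrite coef_curve0.
  have -> : 1 - lam / m.+2%:R = (m.+2%:R - lam) / m.+2%:R.
    by rewrite mulrBl divff.
  by rewrite exprMn exprVn [m.+2%:R ^+ m.+2]exprS invfM mulrACA mulrA.
- exact: coordXY_Per1.
Qed.

Lemma Per1_coord_inj n lam lam' M M' : (1 < n)%N ->
  @Per1 K n lam M -> Per1 n lam' M' -> coordXY n M = coordXY n M' -> M = M'.
Proof.
move=> n1 [f [df bf _] <-] [g [dg bg _] <-]; exact: coordXY_inj.
Qed.

Lemma Per1_intersection m lam lam' : (0 < m)%N ->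
  lam != lam' -> lam * lam' != 0 -> lam * lam' != 1 ->
  exists (s : seq (set (ratmap K))) (mult : set (ratmap K) -> nat),
    [/\ uniq s, [set` s] = Per1 m.+1 lam `&` Per1 m.+1 lam',
        (forall M, M \in s ->
           intersection_multiplicity (coordXY m.+1 @` Per1 m.+1 lam)
             (coordXY m.+1 @` Per1 m.+1 lam') (coordXY m.+1 M) (mult M))
      & (\sum_(M <- s) mult M)%N = m].
Proof.
move=> m0 ll' llp0 llp1; have n1 : (1 < m.+1)%N by [].
have n0 : m.+1%:R != 0 :> K by rewrite pnatr_eq0.
have [lam0 lam'0] : lam != 0 /\ lam' != 0.
  by apply/andP; rewrite -negb_or -mulf_eq0.
have [P [szP topP nextP _ imP]] := Per1_graph m0 lam0.
have [P' [szP' topP' nextP' _ imP']] := Per1_graph m0 lam'0.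
(* The terms in [X ^ (m + 1)] cancel, and this factorisation shows where [lam != lam'] and
   [lam lam' != 1] enter: they make [P - P'] of degree exactly [m]. *)
have QmE : (P - P')`_m = m.+1%:R * (lam - lam') * (lam * lam' - 1) / (lam * lam').
  rewrite coefB nextP nextP'; move: (m.+1%:R : K) => N.
  by field; rewrite lam0 lam'0.
have Qm0 : (P - P')`_m != 0.
  by rewrite QmE !mulf_neq0 ?invr_eq0 ?subr_eq0 ?mulf_neq0.
have szQ : size (P - P') = m.+1.
  apply/eqP; rewrite eqn_leq; apply/andP; split; last first.
    by rewrite ltnNge; apply: contra Qm0 => sz; rewrite nth_default.
  apply/leq_sizeP => i; rewrite leq_eqVlt => /orP[/eqP <-|lti].
    by rewrite coefB topP topP' subrr.
  by rewrite coefB !nth_default ?szP ?szP' // subrr.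
have Q0 : P - P' != 0 by rewrite -size_poly_eq0 szQ.
have [rs [urs rsE rs_sum]] := sum_mup_roots Q0.
(* Choosing a class of the first curve above each abscissa turns the roots of [P - P'] into the list
   of intersection points. *)
have cl_ex x : exists M, Per1 m.+1 lam M /\ coordXY m.+1 M = (x, P.[x]).
  have : [set xy : K * K | xy.2 = P.[xy.1]] (x, P.[x]) by [].
  by rewrite -imP => -[M PM ME]; exists M.
have /boolp.choice[cl clE] := cl_ex.
have onP M : Per1 m.+1 lam M -> (coordXY m.+1 M).2 = P.[(coordXY m.+1 M).1].
  move=> PM; have : (coordXY m.+1 @` Per1 m.+1 lam) (coordXY m.+1 M) by exists M.
  by rewrite imP.
have onP' M : Per1 m.+1 lam' M -> (coordXY m.+1 M).2 = P'.[(coordXY m.+1 M).1].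
  move=> PM; have : (coordXY m.+1 @` Per1 m.+1 lam') (coordXY m.+1 M) by exists M.
  by rewrite imP'.
have rootE x : (x \in rs) = (P.[x] == P'.[x]).
  by rewrite rsE /root hornerD hornerN subr_eq0.
exists (map cl rs), (fun M => mup (coordXY m.+1 M).1 (P - P')); split.
- rewrite map_inj_uniq // => x y cxy.
  by have := (clE x).2; rewrite cxy (clE y).2 => -[].
- apply/seteqP; split=> M /=.
    move=> /mapP[x]; rewrite rootE => /eqP Px ->; split; first exact: (clE x).1.
    (* Above a root, the second curve has a class [M'] with the same coordinates, and injectivity of
       the coordinates identifies it with [cl x]. *)
    have : [set xy : K * K | xy.2 = P'.[xy.1]] (x, P.[x]) by [].
    rewrite -imP' => -[M' PM' ME].
    by rewrite (Per1_coord_inj n1 (clE x).1 PM') // ME (clE x).2.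
  move=> [PM PM']; apply/mapP; exists (coordXY m.+1 M).1.
    by rewrite rootE -onP // -onP'.
  apply: (Per1_coord_inj n1 PM (clE _).1); rewrite (clE _).2 -onP //.
  by case: (coordXY _ _).
- move=> _ /mapP[x _ ->]; rewrite imP imP' (clE x).2 /=.
  exact: intersection_multiplicity_graph.
- rewrite big_map; transitivity (size (P - P')).-1; last by rewrite szQ.
  by rewrite -rs_sum; apply: eq_bigr => x _; rewrite (clE x).2.
Qed.

End IntersectionOfPer1.

Theorem corollary2p5 (R : realType) (n : nat) (hn : (2 <= n)%N) :
  (forall lam : R[i], lam != 0 ->
     exists P : {poly R[i]},
       [/\ size P = n.+1,
           P`_n = - 2,
           P`_(n.-1) = n%:R * (lam + lam^-1 + 1) - 1,
           P`_0 = lam * (n%:R - lam) ^+ n.-1 / n%:R ^+ n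
         & coordXY n @` Per1 n lam = [set xy | xy.2 = P.[xy.1]]])
  /\
  (forall lam lam' : R[i],
     lam != lam' -> lam * lam' != 0 -> lam * lam' != 1 ->
     exists (s : seq (set (ratmap R[i]))) (mult : set (ratmap R[i]) -> nat),
       [/\ uniq s,
           [set` s] = Per1 n lam `&` Per1 n lam',
           (forall m, m \in s ->
              intersection_multiplicity (coordXY n @` Per1 n lam)
                (coordXY n @` Per1 n lam') (coordXY n m) (mult m))
         & (\sum_(m <- s) mult m)%N = n.-1]).
Proof.
case: n hn => [|m] //; rewrite ltnS => m0; split.
  by move=> lam lam0; exact: Per1_graph.
by move=> lam lam'; exact: Per1_intersection.
Qed.
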